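(* Let $n,r,s,d,\delta\in\mathbb N$ with $(r-1)^2\le d+1$. Let $\mathbb F$ be a field of characteristic $p$ with $p=0$ or $p\ge rd\delta(s^2n+\delta)$. Then for every $\epsilon>0$ there is an explicit set $\mathcal H$ of points (in $\mathbb F^n$, or in $\mathbb E^n$ for an extension field $\mathbb E$ of $\mathbb F$ if $\mathbb F$ is too small) of size $|\mathcal H|=O(r^4s^4n^2d\delta^3/\epsilon)$ such that every nonzero polynomial computed by a $\Sigma^{[r]}\wedge^{[d]}\Sigma^{[s]}\Pi^{[\delta]}$ circuit over $\mathbb F$ is nonzero on at least a $(1-\epsilon)$ fraction of the points in $\mathcal H$.
   Context: A polynomial is $s$-sparse if it has at most $s$ monomials with nonzero coefficients. A $\Sigma^{[r]}\wedge^{[d]}\Sigma^{[s]}\Pi^{[\delta]}$ circuit over $\mathbb F$ computes a polynomial in $\mathbb F[x_1,\dots,x_n]$ of the form $\sum_{i=1}^r\alpha_i f_i^d$ with $\alpha_i\in\mathbb F$ and each $f_i$ an $s$-sparse polynomial of degree at most $\delta$. ''Explicit'' means the set can be constructed deterministically in time polynomial in its size. *)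

(* Defs.v *)
From mathcomp Require Export all_boot all_order all_algebra all_field.
From mathcomp Require Export mpoly.

Set Implicit Arguments.
Unset Strict Implicit.
Unset Printing Implicit Defensive.

Import GRing.Theory Num.Theory.
Local Open Scope ring_scope.

(* Circuits sum_{i<r} alpha_i f_i^d, f_i s-sparse of degree at most delta.
   msize is the total degree plus one, and msize 0 = 0. *)

Definition sparse (F : fieldType) (n s : nat) (f : {mpoly F[n]}) : Prop :=
  (size (msupp f) <= s)%N.

Definition sum_pow_sparse (F : fieldType) (n r d s delta : nat)
    (f : {mpoly F[n]}) : Prop :=
  exists (alpha : 'I_r -> F) (g : 'I_r -> {mpoly F[n]}),
    (forall i, sparse s (g i) /\ (msize (g i) <= delta.+1)%N) /\
    f = \sum_(i < r) alpha i *: g i ^+ d.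

Definition has_characteristic (F : fieldType) (p : nat) : Prop :=
  (p = 0%N /\ [pchar F] =i pred0) \/ p \in [pchar F].

(* "Explicit": a model of deterministic computation over a black-box field.
   Programs form a typed first-order call-by-value language with structural
   recursion on naturals and lists, in de Bruijn style.  The syntax does not
   mention the field, so one program runs over all fields.  The only field
   primitives are 0, 1, +, -, *, inverse and an equality test.  Naturals are
   built from 0 and successor only, so no large integer is available at unit
   cost. *)

Inductive ty : Type :=
| TNat
| TFld
| TProd of ty & ty
| TList of ty.

Inductive var : seq ty -> ty -> Type :=
| VZ G A : var (A :: G) A
| VS G A B : var G A -> var (B :: G) A.

Inductive tm : seq ty -> ty -> Type :=
| Var G A : var G A -> tm G A
| Let G A B : tm G A -> tm (A :: G) B -> tm G B
| Pair G A B : tm G A -> tm G B -> tm G (TProd A B)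
| Fst G A B : tm G (TProd A B) -> tm G A
| Snd G A B : tm G (TProd A B) -> tm G B
| Zero G : tm G TNat
| Succ G : tm G TNat -> tm G TNat
| NatCase G A : tm G TNat -> tm G A -> tm (TNat :: G) A -> tm G A
| NatRec G A : tm G TNat -> tm G A -> tm (TNat :: A :: G) A -> tm G A
| Nil G A : tm G (TList A)
| Cons G A : tm G A -> tm G (TList A) -> tm G (TList A)
| ListCase G A B :
    tm G (TList A) -> tm G B -> tm (A :: TList A :: G) B -> tm G B
| ListRec G A B : tm G (TList A) -> tm G B -> tm (A :: B :: G) B -> tm G B
| FZero G : tm G TFld
| FOne G : tm G TFld
| FAdd G : tm G TFld -> tm G TFld -> tm G TFld
| FOpp G : tm G TFld -> tm G TFld
| FMul G : tm G TFld -> tm G TFld -> tm G TFld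
| FInv G : tm G TFld -> tm G TFld
| FIfEq G A : tm G TFld -> tm G TFld -> tm G A -> tm G A -> tm G A.

Fixpoint den (F : fieldType) (A : ty) : Type :=
  match A with
  | TNat => nat
  | TFld => F
  | TProd A B => (den F A * den F B)%type
  | TList A => seq (den F A)
  end.

Fixpoint env (F : fieldType) (G : seq ty) : Type :=
  match G with
  | [::] => unit
  | A :: G => (den F A * env F G)%type
  end.

Fixpoint lookup (F : fieldType) G A (v : var G A) : env F G -> den F A :=
  match v with
  | VZ _ _ => fun e => e.1
  | VS _ _ _ v => fun e => lookup v e.2
  end.

Fixpoint eval (F : fieldType) G A (t : tm G A) : env F G -> den F A :=
  match t in tm G A return env F G -> den F A with
  | Var _ _ v => fun e => lookup v e
  | Let _ _ _ t u => fun e => eval u (eval t e, e)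
  | Pair _ _ _ t u => fun e => (eval t e, eval u e)
  | Fst _ _ _ t => fun e => (eval t e).1
  | Snd _ _ _ t => fun e => (eval t e).2
  | Zero _ => fun _ => 0%N
  | Succ _ t => fun e => (eval t e).+1
  | NatCase _ _ t u w => fun e =>
      if eval t e is k.+1 then eval w (k, e) else eval u e
  | NatRec _ _ t u w => fun e =>
      iteri (eval t e) (fun k a => eval w (k, (a, e))) (eval u e)
  | Nil _ _ => fun _ => [::]
  | Cons _ _ t u => fun e => eval t e :: eval u e
  | ListCase _ _ _ t u w => fun e =>
      if eval t e is x :: l then eval w (x, (l, e)) else eval u e
  | ListRec _ _ _ t u w => fun e =>
      foldr (fun x b => eval w (x, (b, e))) (eval u e) (eval t e)
  | FZero _ => fun _ => 0 : F
  | FOne _ => fun _ => 1 : F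
  | FAdd _ t u => fun e => (eval t e : F) + eval u e
  | FOpp _ t => fun e => - (eval t e : F)
  | FMul _ t u => fun e => (eval t e : F) * eval u e
  | FInv _ t => fun e => (eval t e : F)^-1
  | FIfEq _ _ t u v w => fun e =>
      if (eval t e : F) == eval u e then eval v e else eval w e
  end.

Fixpoint foldr_cost (X B : Type) (f : X -> B -> B) (c : X -> B -> nat) (b : B)
    (l : seq X) : nat :=
  if l is x :: l' then (c x (foldr f b l') + foldr_cost f c b l')%N else 0%N.

(* Running time: every evaluation of a node of the program, including each
   evaluation of the body of a recursion, counts for one step. *)
Fixpoint cost (F : fieldType) G A (t : tm G A) : env F G -> nat :=
  match t in tm G A return env F G -> nat with
  | Var _ _ _ => fun _ => 1%N
  | Let _ _ _ t u => fun e => (cost t e + cost u (eval t e, e)).+1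
  | Pair _ _ _ t u => fun e => (cost t e + cost u e).+1
  | Fst _ _ _ t => fun e => (cost t e).+1
  | Snd _ _ _ t => fun e => (cost t e).+1
  | Zero _ => fun _ => 1%N
  | Succ _ t => fun e => (cost t e).+1
  | NatCase _ _ t u w => fun e =>
      (cost t e + if eval t e is k.+1 then cost w (k, e) else cost u e)%N.+1
  | NatRec _ _ t u w => fun e =>
      (cost t e + cost u e +
       \sum_(k < eval t e)
         cost w (nat_of_ord k,
                 (iteri k (fun j a => eval w (j, (a, e))) (eval u e), e)))%N.+1
  | Nil _ _ => fun _ => 1%N
  | Cons _ _ t u => fun e => (cost t e + cost u e).+1
  | ListCase _ _ _ t u w => fun e =>
      (cost t e + if eval t e is x :: l then cost w (x, (l, e))
                  else cost u e)%N.+1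
  | ListRec _ _ _ t u w => fun e =>
      (cost t e + cost u e +
       foldr_cost (fun x b => eval w (x, (b, e)))
                  (fun x b => cost w (x, (b, e))) (eval u e) (eval t e))%N.+1
  | FZero _ => fun _ => 1%N
  | FOne _ => fun _ => 1%N
  | FAdd _ t u => fun e => (cost t e + cost u e).+1
  | FOpp _ t => fun e => (cost t e).+1
  | FMul _ t u => fun e => (cost t e + cost u e).+1
  | FInv _ t => fun e => (cost t e).+1
  | FIfEq _ _ t u v w => fun e =>
      (cost t e + cost u e +
       if (eval t e : F) == eval u e then cost v e else cost w e)%N.+1
  end.

(* Inputs n, r, s, d, delta, floor(1/eps) and a list of elements of F: an
   abstract field provides no other way to name elements outside its prime
   field.  The output (g, pts) consists of the coefficients, constant term
   first, of a polynomial g such that the points live in E^n for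
   E = F[X]/(g), and of a list of points; a point is the list of its
   coordinates, and a coordinate is the list of coefficients of a (not
   necessarily reduced) polynomial in the class of X. *)
Definition hs_program : Type :=
  tm [:: TNat; TNat; TNat; TNat; TNat; TNat; TList TFld]
     (TProd (TList TFld) (TList (TList (TList TFld)))).

Definition hs_input (F : fieldType) (n r s d delta k : nat) (elts : seq F) :
    env F [:: TNat; TNat; TNat; TNat; TNat; TNat; TList TFld] :=
  (n, (r, (s, (d, (delta, (k, (elts, tt))))))).

Definition root_presents (F : fieldType) (E : fieldExtType F) (g : {poly F})
    (theta : E) : Prop :=
  [/\ irreducible_poly g, root (map_poly (in_alg E) g) theta &
      <<1; theta>>%VS = fullv].

Definition decode_point (F : fieldType) (E : fieldExtType F) (theta : E)
    (n : nat) (pt : seq (seq F)) : {ffun 'I_n -> E} :=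
  [ffun i : 'I_n => (map_poly (in_alg E) (Poly (nth [::] pt i))).[theta]].

Definition nonzero_count (F : fieldType) (E : fieldExtType F) (n : nat)
    (f : {mpoly F[n]}) (H : seq {ffun 'I_n -> E}) : nat :=
  count (fun v : {ffun 'I_n -> E} => (map_mpoly (in_alg E) f).@[v] != 0) H.

(* Main.v *)
Require Import Defs.
From HB Require Import structures.
From Stdlib Require Import Classical.
From mathcomp Require Import fingroup perm zify ring.
Set Implicit Arguments.
Unset Strict Implicit.
Unset Printing Implicit Defensive.
Import Order.TTheory GRing.Theory Num.Theory.
Local Open Scope ring_scope.

(* The points are taken on the curve x_0 = z, x_a = (z + a)^i (0 < a < n) with
   i = r s^2 n, so only the restriction of a circuit to the curve, a polynomial
   in z of degree at most D = d delta i < p, has to be shown nonzero; D (k + 1)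
   parameters z then give an error below eps, where k = floor (1/eps).

   Both nonvanishing facts come from one Mason-Stothers type bound.  If h_0 + ...
   + h_k = 0 is a minimal relation without common factor, all the Wronskians of
   k of the h_j agree up to units, are nonzero in small degree, and have degree
   at most the sum of the degrees minus k (k - 1) / 2; if moreover R times every
   term of such a Wronskian is divisible by the product of the k functions
   involved, then the product of all the h_j divides R times the Wronskian, so
   deg h_j + k (k - 1) / 2 <= deg R for every j.  Applied to monomials on the
   curve, it shows that a nonzero polynomial with few monomials restricts to a
   nonzero one, so pairwise non-proportional sparse polynomials stay so on the
   curve.  Applied to d-th powers of these, it shows that they are linearly
   independent when (r - 1)^2 <= d + 1.

   If F has too few elements, the program lists all tuples of the least length m
   for which there are enough of them, and finds an irreducible monic polynomial
   of degree m by trying all products.  Coordinates are left unreduced modulo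
   this polynomial. *)

(** * Wronskians *)

(** The value i = r s^2 n comes from comparing exponents. In a minimal relation among t monomials on
    the curve, any two exponents of one linear factor differ by at most (n - 1) (t - 1) (t - 2) / 2,
    whereas outside coordinate 0 all such differences are multiples of i; so a larger i makes these
    exponents agree. Coordinate 0 keeps weight 1, so that monomials that differ only there stay
    distinct. Comparing two s-sparse polynomials requires t = 2 s; there are two of them only if r
    >= 2, and then r s^2 n >= 2 s^2 n is large enough. For r = 1 the case t = s suffices.

    The condition (r - 1)^2 <= d + 1 is k^2 - 1 <= d for k = r - 1: for the d-th powers of q_0, ...,
    q_k, R is the product of all q_j^(k - 1), of degree at most k^2 - 1 times the largest deg q_j,
    and it has to be compared with d times that degree.

    In positive characteristic, independent polynomials may have a zero Wronskian, as 1 and X^p do.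
    Hence every argument keeps track of a bound T on the degrees such that 1, ..., T are nonzero in
    the field. *)

Definition lin_indep (F : fieldType) (k : nat) (h : nat -> {poly F}) : Prop :=
  forall c : nat -> F,
    \sum_(j < k) c j *: h j = 0 -> forall j, (j < k)%N -> c j = 0.

Definition wronskian_mx (F : fieldType) (k : nat) (h : nat -> {poly F}) :
    'M[{poly F}]_k := \matrix_(j < k, l < k) (h j)^`(l).

(** Equivalently, the characteristic is zero or exceeds [T]; this form treats both cases at once. *)
Definition small_nat_neq0 (F : fieldType) (T : nat) : Prop :=
  forall m, (0 < m <= T)%N -> m%:R != 0 :> F.

Section Wronskian.

Variables (F : fieldType) (T : nat).
Hypothesis FT : small_nat_neq0 F T.

(* [(v j)' = 0] confines the exponents of [v j] to multiples of the
   characteristic, which exceeds all [size (h j)]: no terms of the products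
   [v j * h j] from different exponents of [v j] can interact. *)
Lemma lin_indep_deriv0 k (h v : nat -> {poly F}) :
    (forall j, (j < k)%N -> (size (h j) <= T.+1)%N) -> lin_indep k h ->
    (forall j, (j < k)%N -> (v j)^`() = 0) ->
  \sum_(j < k) v j * h j = 0 -> forall j, (j < k)%N -> v j = 0.
Proof.
move=> hT hind dv0 vh0.
have va0 j a : (j < k)%N -> (v j)`_a != 0 -> a%:R = 0 :> F.
  case: a => // a jk va; have := congr1 (fun q : {poly F} => q`_a) (dv0 j jk).
  rewrite coef_deriv coef0 -[_ *+ _]mulr_natr => /eqP.
  by rewrite mulf_eq0 (negPf va) => /eqP.
suff key a j : (j < k)%N -> (v j)`_a = 0.
  by move=> j jk; apply/polyP=> a; rewrite coef0 key.
have [a0|a0] := eqVneq (a%:R : F) 0; last first.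
  by move=> jk; apply/eqP/negPn/negP => /(va0 _ _ jk); apply/eqP.
move: j; apply: hind; apply/polyP=> t; rewrite coef0 coef_sum.
have [tT|Tt] := leqP t T; last first.
  rewrite big1 // => j _; rewrite coefZ [(h j)`_t]nth_default ?mulr0 //.
  exact: leq_trans (hT _ (ltn_ord j)) Tt.
have := congr1 (fun q : {poly F} => q`_(a + t)) vh0.
rewrite coef0 coef_sum => e; rewrite -[RHS]e; apply: eq_bigr => j _.
rewrite coefZ coefM.
have aT : (a < (a + t).+1)%N by rewrite ltnS leq_addr.
rewrite (bigD1 (Ordinal aT)) //= addKn big1 ?addr0 // => b /eqP ba.
have [-> | vb] := eqVneq (v j)`_b 0; first by rewrite mul0r.
have b0 := va0 _ _ (ltn_ord j) vb.
rewrite [(h j)`_ _]nth_default ?mulr0 //.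
apply: leq_trans (hT _ (ltn_ord j)) _; rewrite ltnNge; apply/negP => le_T.
have neq : nat_of_ord b <> a by move=> eqba; apply: ba; apply: val_inj.
have bt := ltn_ord b.
have [ltba|ltab|//] := ltngtP b a.
  have /negP[] := FT (m := (a - b)%N) ltac:(lia).
  by rewrite natrB ?a0 ?b0 ?subr0 //; lia.
have /negP[] := FT (m := (b - a)%N) ltac:(lia).
by rewrite natrB ?a0 ?b0 ?subr0 //; lia.
Qed.

(* A kernel vector of the matrix with last coordinate of least size is killed
   by differentiation, since its derivative is again a kernel vector. *)
Lemma wronskian_neq0 k (h : nat -> {poly F}) :
    (forall j, (j < k)%N -> (size (h j) <= T.+1)%N) -> lin_indep k h ->
  \det (wronskian_mx k h) != 0.
Proof.
elim: k => [|k IHk] hT hind; first by rewrite det_mx00 oner_eq0.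
have {IHk} W0 : \det (wronskian_mx k h) != 0.
  apply: IHk => [j jk|c]; first by apply: hT; apply: ltnW.
  move=> c0 j jk.
  have := hind (fun j => if (j < k)%N then c j else 0).
  rewrite big_ord_recr /= ltnn scale0r addr0.
  under eq_bigr => i _ do rewrite ltn_ord.
  by move=> /(_ c0 j (ltnW jk)); rewrite jk.
have ker0 (v : nat -> {poly F}) :
    (forall l, (l < k)%N -> \sum_(j < k) v j * (h j)^`(l) = 0) ->
    forall j, (j < k)%N -> v j = 0.
  move=> v0 j jk; apply/eqP/negPn/negP => vj.
  case/negP: W0; apply/det0P; exists (\row_j v j).
    apply/eqP => /rowP /(_ (Ordinal jk)) /eqP; rewrite !mxE /=; exact/negP.
  apply/rowP => l; rewrite !mxE -[RHS](v0 l (ltn_ord l)).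
  by apply: eq_bigr => i _; rewrite !mxE.
apply/negP => /det0P [v0 v0n0 v0ker].
pose isker (v : nat -> {poly F}) := 
  forall l, (l < k.+1)%N -> \sum_(j < k.+1) v j * (h j)^`(l) = 0.
have last0 v : isker v -> v k = 0 -> forall j, (j < k.+1)%N -> v j = 0.
  move=> vker vk j; rewrite ltnS leq_eqVlt => /predU1P[->//|].
  apply: ker0 => l lk; have := vker l (ltnW lk).
  by rewrite big_ord_recr /= vk mul0r addr0.
suff main m (v : nat -> {poly F}) : (size (v k) < m)%N -> isker v -> forall j, (j < k.+1)%N -> v j = 0.
  case/eqP: v0n0; apply/rowP => j; rewrite mxE.
  pose v j : {poly F} := v0 0 (inord j).
  have -> : v0 0 j = v j by rewrite /v inord_val.
  apply: (main _ v (leqnn _)) (ltn_ord j) => l lk.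
  have /rowP /(_ (Ordinal lk)) := v0ker; rewrite !mxE => ker_l.
  by rewrite -[RHS]ker_l; apply: eq_bigr => i _; rewrite !mxE /v inord_val.
elim: m v => // m IHm v vm vker.
have [vk0|vk] := eqVneq (v k) 0; first exact: last0.
have dsum l : (l < k.+1)%N -> \sum_(j < k.+1) (v j)^`() * (h j)^`(l) =
    - \sum_(j < k.+1) v j * (h j)^`(l.+1).
  move=> lk; apply/eqP; rewrite -subr_eq0 opprK -big_split /=.
  have := congr1 (@deriv _) (vker l lk); rewrite raddf_sum raddf0 => dv_l.
  by apply/eqP; rewrite -[RHS]dv_l; apply: eq_bigr => j _; rewrite /= derivM /=.
have dker l : (l < k)%N -> \sum_(j < k.+1) (v j)^`() * (h j)^`(l) = 0.
  by move=> lk; rewrite dsum ?vker ?oppr0 // ltnS ltnW.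
(* The difference of the two sides is orthogonal to the derivatives of orders below [k] and has last
   coordinate zero, so [ker0] applies. Thus the derivative of [v] is proportional to [v] over the
   fraction field, which puts it in the kernel for order [k] too. *)
have prop j : (j < k.+1)%N -> v k * (v j)^`() = (v k)^`() * v j.
  rewrite ltnS leq_eqVlt => /predU1P[->|jk]; first exact: mulrC.
  apply/eqP; rewrite -subr_eq0; apply/eqP.
  apply: (ker0 (fun j => v k * (v j)^`() - (v k)^`() * v j)) jk => l lk.
  have e1 : \sum_(j < k.+1) (v k * (v j)^`() - (v k)^`() * v j) * (h j)^`(l) = 0.
    transitivity (v k * \sum_(j < k.+1) (v j)^`() * (h j)^`(l) -
        (v k)^`() * \sum_(j < k.+1) v j * (h j)^`(l)).
      rewrite !mulr_sumr -sumrB; apply: eq_bigr => i _.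
      by rewrite mulrBl !mulrA.
    by rewrite dker ?vker ?mulr0 ?subr0 // ltnW.
  by move: e1; rewrite big_ord_recr /= [v k * (v k)^`()]mulrC subrr mul0r addr0.
have dvker : isker (fun j => (v j)^`()).
  move=> l; rewrite ltnS leq_eqVlt => /predU1P[->|]; last exact: dker.
  apply: (mulfI vk); rewrite mulr0 mulr_sumr.
  under eq_bigr => j _ do rewrite mulrA prop // -mulrA.
  by rewrite -mulr_sumr vker // mulr0.
have dv0 := IHm _ (leq_trans (lt_size_deriv vk) vm) dvker.
by apply: (lin_indep_deriv0 hT hind dv0); have := vker 0%N isT.
Qed.

End Wronskian.

(** For j < k this lists the indices 0, ..., k without [j0], with [k] in the slot of [j0]; for
    [j0 = k] it changes nothing. *)
Definition swap_out (k j0 j : nat) : nat := if j == j0 then k else j.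

(** * Degrees, divisibility and gcds in families of polynomials *)

Section PolyAux.

Variable F : fieldType.
Implicit Types (p q : {poly F}).

Definition pdeg p := (size p).-1.

Lemma pdegM p q : p != 0 -> q != 0 -> pdeg (p * q) = (pdeg p + pdeg q)%N.
Proof.
rewrite /pdeg -!size_poly_gt0 => p0 q0; rewrite size_mul -?size_poly_gt0 //.
move: p0 q0; move: (size p) (size q) => a b; lia.
Qed.

Lemma pdeg_prod (I : Type) (s : seq I) (P : pred I) (f : I -> {poly F}) :
    (forall i, P i -> f i != 0) ->
  pdeg (\prod_(i <- s | P i) f i) = (\sum_(i <- s | P i) pdeg (f i))%N.
Proof.
move=> f0.
suff: \prod_(i <- s | P i) f i != 0 /\
    pdeg (\prod_(i <- s | P i) f i) = (\sum_(i <- s | P i) pdeg (f i))%N by case.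
elim/big_rec2: _ => [|i m p Pi [p0 <-]]; first by rewrite oner_eq0 /pdeg size_poly1.
by rewrite mulf_neq0 ?f0 // pdegM ?f0.
Qed.

Lemma pdegX p m : p != 0 -> pdeg (p ^+ m) = (pdeg p * m)%N.
Proof. by move=> p0; rewrite /pdeg size_exp. Qed.

Lemma leq_pdeg_dvd p q : q != 0 -> p %| q -> (pdeg p <= pdeg q)%N.
Proof. by move=> q0 /(dvdp_leq q0); rewrite /pdeg; move: (size p) (size q); lia. Qed.

Lemma size_derivn_le p l : p^`(l) != 0 -> (pdeg p^`(l) + l <= pdeg p)%N.
Proof.
elim: l => [|l IHl]; first by rewrite derivn0 addn0.
rewrite derivnS => d0.
have dl0 : p^`(l) != 0 by apply: contraNneq d0 => ->; rewrite linear0.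
have := IHl dl0; have := lt_size_deriv dl0; move: d0.
rewrite /pdeg -size_poly_gt0.
by move: (size p) (size _^`(l)) (size _^`()) => a b c; lia.
Qed.

Lemma dvdp_prod (I : Type) (s : seq I) (P : pred I) (f g : I -> {poly F}) :
    (forall i, P i -> f i %| g i) ->
  \prod_(i <- s | P i) f i %| \prod_(i <- s | P i) g i.
Proof.
by move=> fg; elim/big_rec2: _ => [|i p q Pi pq]; rewrite ?dvdp_mul ?dvdpp ?fg.
Qed.

(** This replaces a Bezout identity: multiplication by [q] commutes with gcds up to a unit. The
    empty gcd is 0, the neutral element of [gcdp]. *)
Lemma dvdp_big_gcd m (h : nat -> {poly F}) p q :
    (forall j, (j < m)%N -> p %| h j * q) ->
  p %| (\big[@gcdp F/0]_(j < m) h j) * q.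
Proof.
elim: m h => [|m IHm] h ph; first by rewrite big_ord0 mul0r dvdp0.
rewrite big_ord_recl /= (eqp_dvdr _ (mulp_gcdl _ _ _)) dvdp_gcd ph //=.
under eq_bigr => i _ do rewrite /bump add1n.
by apply: (IHm (fun j => h j.+1)) => j jm; apply: ph.
Qed.

Lemma big_gcd_dvdp m (h : nat -> {poly F}) j :
  (j < m)%N -> \big[@gcdp F/0]_(j < m) h j %| h j.
Proof.
elim: m h j => // m IHm h [|j] jm; rewrite big_ord_recl /=; first exact: dvdp_gcdl.
apply: dvdp_trans (dvdp_gcdr _ _) _.
under eq_bigr => i _ do rewrite /bump add1n.
exact: (IHm (fun j => h j.+1)).
Qed.

End PolyAux.

Lemma prod_swap_out (F : fieldType) k (h : nat -> {poly F}) j0 : (j0 <= k)%N ->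
  h j0 * \prod_(j < k) h (swap_out k j0 j) = \prod_(j < k.+1) h j.
Proof.
move=> j0k; rewrite big_ord_recr /=; move: j0k; rewrite leq_eqVlt => /predU1P[->|j0k].
  rewrite mulrC; congr (_ * _); apply: eq_bigr => j _.
  by rewrite /swap_out ltn_eqF.
rewrite (bigD1 (Ordinal j0k)) //= [in RHS](bigD1 (Ordinal j0k)) //=.
rewrite {1}/swap_out eqxx mulrCA [RHS]mulrC; congr (_ * (_ * _)).
apply: eq_bigr => j ne; rewrite /swap_out ifN //.
Qed.

(** * The degree bound for a coprime minimal relation *)

Section CoprimeRelation.

Variables (F : fieldType) (T k : nat) (h : nat -> {poly F}) (R : {poly F}).
Hypothesis FT : small_nat_neq0 F T.
Hypothesis h_size : forall j, (j <= k)%N -> (size (h j) <= T.+1)%N.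
Hypothesis h_neq0 : forall j, (j <= k)%N -> h j != 0.
Hypothesis h_sum0 : \sum_(j < k.+1) h j = 0.
Hypothesis h_indep : lin_indep k h.
Hypothesis h_coprime : \big[@gcdp F/0]_(j < k.+1) h j %| 1.
Hypothesis R_neq0 : R != 0.
Hypothesis R_dvd : forall j0 (f : 'S_k), (j0 <= k)%N ->
  \prod_(j < k) h (swap_out k j0 j) %|
    R * \prod_(j < k) (h (swap_out k j0 j))^`(f j).

Let W j0 := wronskian_mx k (h \o swap_out k j0).

(** By the relation, the row of the omitted function is minus the sum of the other rows. Exchanging
    [k] for [j0] is therefore multiplication by [E], whose row [j0] is constantly -1. [E] works in
    both directions, so its determinant need not be computed. *)
Let det_swap j0 : (j0 <= k)%N ->
  \det (W k) %| \det (W j0) /\ \det (W j0) %| \det (W k).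
Proof.
rewrite leq_eqVlt => /predU1P[->|j0k]; first by rewrite dvdpp.
pose E : 'M[{poly F}]_k :=
  \matrix_(j, l) if j == Ordinal j0k then -1 else (j == l)%:R.
have dsum l : \sum_(j < k) (h j)^`(l) = - (h k)^`(l).
  apply/eqP; rewrite -addr_eq0; apply/eqP.
  have := congr1 (derivn l) h_sum0; rewrite big_ord_recr /= derivnD.
  by rewrite (raddf_sum (derivn l)) (raddf0 (derivn l)).
have rowE (B : 'M[{poly F}]_k) j l : (E *m B) j l =
    if j == Ordinal j0k then - \sum_i B i l else B j l.
  rewrite !mxE; case: ifP => [/eqP->|/negbT ne].
    by rewrite -sumrN; apply: eq_bigr => i _; rewrite !mxE eqxx mulN1r.
  rewrite (bigD1 j) //= !mxE (negPf ne) eqxx mul1r big1 ?addr0 // => i ij.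
  by rewrite !mxE (negPf ne) eq_sym (negPf ij) mul0r.
have Wk j l : W k j l = (h j)^`(l) by rewrite mxE /= /swap_out ltn_eqF.
have Wj j l : W j0 j l = if j == Ordinal j0k then (h k)^`(l) else (h j)^`(l).
  by rewrite mxE /= /swap_out -val_eqE /=; case: ifP.
have e1 : W j0 = E *m W k.
  apply/matrixP => j l; rewrite rowE Wj; case: ifP => _; last by rewrite Wk.
  by under eq_bigr do rewrite Wk; rewrite dsum opprK.
have e2 : W k = E *m W j0.
  apply/matrixP => j l; rewrite rowE; case: ifP => [/eqP->|ne]; last first.
    by rewrite Wk Wj ne.
  rewrite (bigD1 (Ordinal j0k)) //= Wj eqxx Wk /=.
  under eq_bigr => i /negPf ne do rewrite Wj ne.
  have := dsum l; rewrite (bigD1 (Ordinal j0k)) //= => /eqP.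
  rewrite -subr_eq0 opprK => /eqP e; apply/eqP; rewrite -subr_eq0 opprK.
  by rewrite -[X in _ == X]e addrC -addrA [X in _ + X]addrC addrA.
split; first by rewrite e1 det_mulmx dvdp_mull.
by rewrite e2 det_mulmx dvdp_mull.
Qed.

Let dvd_det j0 : (j0 <= k)%N ->
  \prod_(j < k) h (swap_out k j0 j) %| R * \det (W j0).
Proof.
move=> j0k; rewrite /determinant mulr_sumr.
apply: (big_ind (fun q => _ %| q)) => [|p q ? ?|f _]; [exact: dvdp0 | exact: dvdp_add |].
rewrite mulrCA dvdp_mull //.
have -> : \prod_(i < k) W j0 i (f i) = \prod_(j < k) (h (swap_out k j0 j))^`(f j).
  by apply: eq_bigr => i _; rewrite mxE.
exact: R_dvd.
Qed.

(** For each j, the product of all the h's divides h_j times R times the Wronskian that omits j.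
    These Wronskians divide one another, so the gcd of the h_j can be taken with one of them fixed;
    as that gcd is a unit, the factor h_j disappears. In the comparison of degrees only [h j0]
    survives on the left. *)
Lemma coprime_relation_pdeg j0 : (j0 <= k)%N ->
  (pdeg (h j0) + \sum_(j < k) j <= pdeg R)%N.
Proof.
move=> j0k.
have Wk0 : \det (W k) != 0.
  have -> : W k = wronskian_mx k h.
    by apply/matrixP => j l; rewrite !mxE /= /swap_out ltn_eqF.
  by apply: (wronskian_neq0 FT) h_indep => j /ltnW; apply: h_size.
have W0 : \det (W j0) != 0.
  by apply: contraNneq Wk0 => e; case: (det_swap j0k) => _; rewrite e dvd0p.
have sw_le j : (j < k)%N -> (swap_out k j0 j <= k)%N.
  by move=> jk; rewrite /swap_out; case: ifP => // _; apply: ltnW.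
have hs0 (j : 'I_k) : h (swap_out k j0 j) != 0 by rewrite h_neq0 ?sw_le.
have dvd_all : \prod_(j < k.+1) h j %| R * \det (W j0).
  have : \prod_(j < k.+1) h j %|
      (\big[@gcdp F/0]_(j < k.+1) h j) * (R * \det (W j0)).
    apply: dvdp_big_gcd => j jk; rewrite -(@prod_swap_out F k h j jk).
    rewrite dvdp_mul2l ?h_neq0 //.
    apply: dvdp_trans (dvd_det jk) (dvdp_mul (dvdpp _) _).
    by apply: dvdp_trans (det_swap jk).2 (det_swap j0k).1.
  move/dvdp_trans; apply; rewrite -[X in _ %| X]mul1r dvdp_mul2r //.
  exact: mulf_neq0.
set S := (\sum_(j < k) pdeg (h (swap_out k j0 j)))%N.
set L := (\sum_(j < k) j)%N.
have deg_le : (pdeg (h j0) + S <= pdeg R + pdeg (\det (W j0)))%N.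
  rewrite -pdegM // /S -pdeg_prod // -pdegM ?h_neq0 //; last by apply/prodf_neq0.
  by rewrite prod_swap_out // leq_pdeg_dvd // mulf_neq0.
(* The subtraction is truncated: for L > S every term of the determinant is zero, and the bound is
   0. A nonzero term loses at least [f j] degrees in row [j], and these losses add up to [L] for
   every permutation. *)
have sz : (size (\det (W j0)) <= S.+1 - L)%N.
  rewrite /determinant; elim/big_ind: _ => [|p q lep leq|f _].
  - by rewrite size_poly0.
  - by apply: leq_trans (size_polyD _ _) _; rewrite geq_max lep.
  have -> : \prod_(i < k) W j0 i (f i) = \prod_(j < k) (h (swap_out k j0 j))^`(f j).
    by apply: eq_bigr => i _; rewrite mxE.
  rewrite -signr_odd; set b := odd _; rewrite mulr_sign.
  have -> : forall q : {poly F}, size (if b then - q else q) = size q.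
    by move=> q; case: b; rewrite ?size_polyN.
  set q := \prod_(j < k) _; have [->|q0] := eqVneq q 0; first by rewrite size_poly0.
  have qj0 (j : 'I_k) : (h (swap_out k j0 j))^`(f j) != 0.
    by move: q0; rewrite /q => /prodf_neq0; apply.
  have Lf : L = (\sum_(j < k) f j)%N.
    by rewrite /L (reindex_inj (@perm_inj _ f)).
  suff : (pdeg q + L <= S)%N by move: q0; rewrite /pdeg -size_poly_gt0; lia.
  rewrite /q pdeg_prod // Lf -big_split /=; apply: leq_sum => j _.
  exact: size_derivn_le.
move: deg_le sz W0; rewrite [pdeg (\det _)]/pdeg -size_poly_gt0.
by move: (size _) S L (pdeg R) (pdeg _); lia.
Qed.

End CoprimeRelation.

(** * Minimal linear relations *)

Section MinimalRelation.

Variables (F : fieldType) (I : eqType) (f : I -> {poly F}).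

(** Induction on the length: if the members of [t] satisfy a nontrivial relation, the part of [t]
    with nonzero coefficients is a shorter relation to continue with. *)
Lemma minimal_subrelation (s : seq I) (c : I -> F) :
    uniq s -> s != [::] -> (forall i, i \in s -> c i != 0) ->
    \sum_(i <- s) c i *: f i = 0 ->
  exists x t (c' : I -> F), [/\ uniq (x :: t), {subset x :: t <= s},
    (forall i, i \in x :: t -> c' i != 0),
    \sum_(i <- x :: t) c' i *: f i = 0 &
    forall d : I -> F, \sum_(i <- t) d i *: f i = 0 ->
      forall i, i \in t -> d i = 0].
Proof.
have [m] := ubnP (size s); elim: m s c => // m IHm [|x t] c szs us // _ c0 sum0.
case: (classic (forall d : I -> F, \sum_(i <- t) d i *: f i = 0 ->
      forall i, i \in t -> d i = 0)) => [ind|].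
  by exists x, t, c; split.
move=> nind.
have [d d0 [y yt dy]] : exists2 d : I -> F, \sum_(i <- t) d i *: f i = 0 &
    exists2 y, y \in t & d y != 0.
  apply: NNPP => nex; apply: nind => d d0 y yt; apply/eqP/negPn/negP => dy.
  by apply: nex; exists d => //; exists y.
pose t' := [seq i <- t | d i != 0].
have yt' : y \in t' by rewrite mem_filter yt dy.
have st' : {subset t' <= x :: t}.
  by move=> i; rewrite mem_filter inE => /andP[_ ->]; rewrite orbT.
have [|||||z [v [c' [h1 h2 h3 h4 h5]]]] := IHm t' d.
- by rewrite size_filter (leq_ltn_trans (count_size _ _)).
- by rewrite filter_uniq //; case/andP: us.
- by case: (t') yt'.
- by move=> i; rewrite mem_filter => /andP[].
- rewrite big_filter big_mkcond -[RHS]d0; apply: eq_bigr => i _.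
  by case: eqP => //= ->; rewrite scale0r.
by exists z, v, c'; split=> // i /h2 /st'.
Qed.

(** The same result in the shape that the Wronskian bound expects: members are indexed by naturals,
    coefficients are absorbed into the functions, and the first [k] of the [k + 1] members are
    independent. *)
Lemma minimal_relation (s : seq I) (c : I -> F) x :
    uniq s -> \sum_(i <- s) c i *: f i = 0 -> x \in s -> c x != 0 ->
  exists k (e : nat -> I) (c' : nat -> F), (k < size s)%N /\
    [/\ forall j, (j <= k)%N -> e j \in s,
        forall j l, (j <= k)%N -> (l <= k)%N -> e j = e l -> j = l,
        forall j, (j <= k)%N -> c' j != 0,
        \sum_(j < k.+1) c' j *: f (e j) = 0 &
        lin_indep k (fun j => c' j *: f (e j))].
Proof.
move=> us sum0 xs cx.
have [||||y [t [d [uyt syt d0 dsum dind]]]] :=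
    @minimal_subrelation [seq i <- s | c i != 0] c.
- exact: filter_uniq.
- have : x \in [seq i <- s | c i != 0] by rewrite mem_filter cx.
  by case: [seq _ <- _ | _].
- by move=> i; rewrite mem_filter => /andP[].
- rewrite big_filter big_mkcond -[RHS]sum0; apply: eq_bigr => i _.
  by case: eqP => //= ->; rewrite scale0r.
have {}syt : {subset y :: t <= s} by move=> i /syt; rewrite mem_filter => /andP[].
(* The distinguished member goes last, so the independent ones are exactly those of index below
   [size t]. *)
pose u := rcons t y; pose e j := nth y u j.
have szu : size u = (size t).+1 by rewrite size_rcons.
have uu : uniq u by rewrite rcons_uniq.
have eu j : (j <= size t)%N -> e j \in u by move=> jt; rewrite mem_nth ?szu.
have uyt' i : i \in u -> i \in y :: t by rewrite mem_rcons.
exists (size t), e, (fun j => d (e j)); split.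
  by apply: (@leq_trans (size (y :: t))) => //; apply: uniq_leq_size.
split=> [j jt|j l jt lt /eqP|j jt||b bsum j jt].
- by apply/syt/uyt'/eu.
- by rewrite nth_uniq ?szu // => /eqP.
- by apply/d0/uyt'/eu.
- have -> : \sum_(j < (size t).+1) d (e j) *: f (e j) = \sum_(i <- u) d i *: f i.
    by rewrite (big_nth y) szu big_mkord.
  by rewrite /u -cats1 big_cat /= big_seq1 addrC -[RHS]dsum big_cons.
have et l : (l < size t)%N -> e l = nth y t l by move=> lt; rewrite /e nth_rcons lt.
(* The coefficients [b], given on positions, are carried to elements of [I] by [index]; this is
   sound because [t] has no repetitions. *)
suff /(_ (e j)) : forall i, i \in t -> b (index i t) * d i = 0.
  rewrite et // mem_nth // index_uniq //; last by case/andP: uyt.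
  move=> /(_ isT) /eqP; rewrite mulf_eq0 => /orP[/eqP//|].
  by rewrite (negPf (d0 _ _)) // inE mem_nth ?orbT.
apply: dind; rewrite (big_nth y) big_mkord -[RHS]bsum; apply: eq_bigr => l _.
by rewrite scalerA et // index_uniq //; case/andP: uyt.
Qed.

End MinimalRelation.

(** * Divisibility of higher derivatives *)

Section LogDerivative.

Variable F : fieldType.
Implicit Types (p q h rho : {poly F}).

(** In other words, [rho] clears the denominator of the logarithmic derivative of [h]. *)
Definition log_dvd rho h := h %| rho * h^`().

(** Suppose that rho^l times the l-th derivative of h is u h. Differentiating and multiplying by rho
    shows that rho^(l+1) times the next derivative is rho (u h)' minus l rho' u h, and [h] divides
    both parts. *)
Lemma log_dvd_derivn rho h l : log_dvd rho h -> h %| rho ^+ l * h^`(l).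
Proof.
move=> hlog; elim: l => [|l IHl]; first by rewrite mul1r derivn0.
have /dvdpP [u e] := IHl.
have := congr1 (fun q => rho * q^`()) e; rewrite /= !derivM => e'.
have -> : rho ^+ l.+1 * h^`(l.+1) = rho * (u^`() * h + u * h^`()) -
    (rho * (rho ^+ l)^`()) * h^`(l).
  by rewrite -e' exprS derivnS; ring.
apply: dvdp_sub; first rewrite mulrDr dvdp_add //.
- by rewrite mulrA dvdp_mull.
- by rewrite mulrCA dvdp_mull.
have -> : rho * (rho ^+ l)^`() * h^`(l) = rho^`() *+ l * (rho ^+ l * h^`(l)).
  rewrite deriv_exp; case: l {IHl e e'} => [|l]; first by rewrite !mulr0n !(mulr0, mul0r).
  by rewrite /= exprS; ring.
exact: dvdp_mull.
Qed.

Lemma log_dvd_exp p m : log_dvd p (p ^+ m).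
Proof.
rewrite /log_dvd deriv_exp; case: m => [|m]; first by rewrite dvd1p.
by rewrite /= mulrnAr mulrCA -exprS -mulrnAl dvdp_mull.
Qed.

Lemma log_dvdM rho1 rho2 p q :
  log_dvd rho1 p -> log_dvd rho2 q -> log_dvd (rho1 * rho2) (p * q).
Proof.
move=> lp lq; rewrite /log_dvd derivM mulrDr dvdp_add //.
  have -> : rho1 * rho2 * (p^`() * q) = (rho1 * p^`()) * (rho2 * q) by ring.
  by rewrite dvdp_mul // dvdp_mull.
have -> : rho1 * rho2 * (p * q^`()) = (rho1 * p) * (rho2 * q^`()) by ring.
by rewrite dvdp_mul // dvdp_mull.
Qed.

Lemma log_dvd_prod (J : Type) (s : seq J) (p rho : J -> {poly F}) :
    (forall a, log_dvd (rho a) (p a)) ->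
  log_dvd (\prod_(a <- s) rho a) (\prod_(a <- s) p a).
Proof.
move=> lp; elim/big_rec2: _ => [|a q q' _ lq]; last exact: log_dvdM.
by rewrite /log_dvd dvd1p.
Qed.

Lemma log_dvdZ rho p c : c != 0 -> log_dvd rho p -> log_dvd rho (c *: p).
Proof.
by move=> c0; rewrite /log_dvd derivZ -scalerAr dvdpZl // dvdpZr.
Qed.

End LogDerivative.

(** * Linear independence of d-th powers *)

Section PowerIndependence.

Variable F : fieldType.

(** The cofactors of the gcd are coprime, and so are their powers. *)
Lemma gcdp_pow (p q : {poly F}) d : gcdp (p ^+ d) (q ^+ d) %= gcdp p q ^+ d.
Proof.
have [/eqP|g0] := eqVneq (gcdp p q) 0.
  rewrite gcdp_eq0 => /andP[/eqP-> /eqP->]; by rewrite !gcdpp eqpxx.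
set g := gcdp p q in g0 *.
have [a ep] := dvdpP _ _ (dvdp_gcdl p q).
have [b eq] := dvdpP _ _ (dvdp_gcdr p q).
have cab : coprimep a b.
  have : g * gcdp a b %= g * 1.
    by rewrite mulr1 (eqp_trans (mulp_gcdr _ _ _)) // mulrC -ep mulrC -eq eqpxx.
  by rewrite eqp_mul2l // gcdp_eqp1.
have : gcdp (a ^+ d) (b ^+ d) %= 1.
  by rewrite gcdp_eqp1 coprimep_expl ?coprimep_expr.
rewrite -(eqp_mul2r _ _ (expf_neq0 d g0)) mul1r.
apply: eqp_trans; rewrite eqp_sym (eqp_trans (mulp_gcdl _ _ _)) //.
by rewrite -!exprMn -ep -eq eqpxx.
Qed.

Lemma big_gcd_pow m (q : nat -> {poly F}) d :
  \big[@gcdp F/0]_(j < m) q j %| 1 -> \big[@gcdp F/0]_(j < m) (q j ^+ d) %| 1.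
Proof.
case: m => [|m]; first by rewrite !big_ord0.
suff e : \big[@gcdp F/0]_(j < m.+1) (q j ^+ d) %=
    (\big[@gcdp F/0]_(j < m.+1) q j) ^+ d.
  by move=> h; rewrite (eqp_dvdl _ e) -(expr1n _ d) dvdp_exp2r.
elim: m q => [|m IHm] q.
  rewrite !big_ord_recl !big_ord0.
  by rewrite !gcdp0 eqpxx.
rewrite big_ord_recl [in X in _ %= X]big_ord_recl /=.
apply: eqp_trans (gcdp_pow _ _ _).
exact: eqp_gcd (eqpxx _) (IHm (fun j => q j.+1)).
Qed.

Lemma pdeg_eq0P (p : {poly F}) : pdeg p = 0%N -> p = (p`_0)%:P.
Proof. by move=> p0; apply: size1_polyC; move: p0; rewrite /pdeg; move: (size p); lia. Qed.

Lemma pdegZ c (p : {poly F}) : c != 0 -> pdeg (c *: p) = pdeg p.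
Proof. by move=> c0; rewrite /pdeg size_scale. Qed.

(** A nontrivial relation contains a minimal one with k + 1 <= r members. Dividing the bases by
    their gcd [D] makes the relation coprime, and the degree bound is applied to the quotient [q m]
    of largest degree. *)
Lemma power_lin_indep (I : eqType) (f : I -> {poly F}) (s : seq I) r d T
    (c : I -> F) :
    small_nat_neq0 F T -> uniq s -> (size s <= r)%N -> (0 < d)%N ->
    ((r - 1) ^ 2 <= d + 1)%N ->
    (forall i, i \in s -> f i != 0 /\ (size (f i ^+ d) <= T.+1)%N) ->
    (forall i j a, i \in s -> j \in s -> i != j -> f i <> a *: f j) ->
    \sum_(i <- s) c i *: f i ^+ d = 0 ->
  forall i, i \in s -> c i = 0.
Proof.
move=> FT us szs d_gt0 rd fs nprop sum0 x xs; apply/eqP/negPn/negP => cx.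
have [k [e [b [ks [es einj b0 bsum bind]]]]] := minimal_relation us sum0 xs cx.
have fe0 j : (j <= k)%N -> f (e j) != 0 by move=> jk; case: (fs _ (es j jk)).
set D := \big[@gcdp F/0]_(j < k.+1) f (e j).
have Df j : (j <= k)%N -> D %| f (e j).
  by move=> jk; exact: (big_gcd_dvdp (fun j => f (e j))).
have D0 : D != 0.
  by apply: contraNneq (fe0 0%N isT) => D0; have := Df 0%N isT; rewrite D0 dvd0p.
pose q j := f (e j) %/ D.
have fq j : (j <= k)%N -> f (e j) = q j * D by move=> jk; rewrite divpK ?Df.
have q0 j : (j <= k)%N -> q j != 0.
  by move=> jk; have := fe0 j jk; rewrite fq // mulf_eq0 => /norP[].
pose h j := b j *: q j ^+ d.
have hD j : (j <= k)%N -> b j *: f (e j) ^+ d = h j * D ^+ d.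
  by move=> jk; rewrite fq // exprMn /h scalerAl.
have Dd0 : D ^+ d != 0 by rewrite expf_neq0.
have h0 j : (j <= k)%N -> h j != 0.
  by move=> jk; rewrite scaler_eq0 negb_or b0 //= expf_neq0 ?q0.
have hsum : \sum_(j < k.+1) h j = 0.
  apply: (mulIf Dd0); rewrite mul0r mulr_suml -[RHS]bsum; apply: eq_bigr => j _.
  by rewrite hD // -ltnS.
have hind : lin_indep k h.
  move=> a asum; apply: bind.
  transitivity ((\sum_(j < k) a j *: h j) * D ^+ d); last by rewrite asum mul0r.
  rewrite mulr_suml; apply: eq_bigr => j _; rewrite -scalerAl hD //; exact: ltnW.
have hsize j : (j <= k)%N -> (size (h j) <= T.+1)%N.
  move=> jk; rewrite /h size_scale ?b0 //.
  apply: leq_trans (fs _ (es j jk)).2; apply: dvdp_leq; first by rewrite expf_neq0 ?fe0.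
  by rewrite dvdp_exp2r // fq // dvdp_mulr.
have qcop : \big[@gcdp F/0]_(j < k.+1) q j %| 1.
  rewrite -(dvdp_mul2r _ _ D0) mul1r.
  rewrite -[X in _ %| X]mulr1; apply: (@dvdp_big_gcd F k.+1 (fun j => f (e j))) => j jk; rewrite mulr1.
  by rewrite fq // dvdp_mul // (big_gcd_dvdp _ jk).
have hcop : \big[@gcdp F/0]_(j < k.+1) h j %| 1.
  apply: dvdp_trans (big_gcd_pow d qcop); rewrite -[X in _ %| X]mulr1.
  apply: (dvdp_big_gcd (h := fun j => q j ^+ d)) => j jk; rewrite mulr1.
  apply: dvdp_trans (big_gcd_dvdp h jk) _; by rewrite dvdpZl ?b0.
(* Derivatives in a Wronskian of [k] functions have order at most [k.-1], and each one costs a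
   factor [q j]. All [k + 1] quotients enter because the same [R] must serve whichever function is
   omitted. *)
pose R := \prod_(j < k.+1) q j ^+ k.-1.
have R0 : R != 0 by apply/prodf_neq0 => j _; rewrite expf_neq0 ?q0 // -ltnS.
have Rdvd j0 (g : 'S_k) : (j0 <= k)%N ->
    \prod_(j < k) h (swap_out k j0 j) %|
    R * \prod_(j < k) (h (swap_out k j0 j))^`(g j).
  move=> j0k; rewrite /R -(@prod_swap_out F k (fun j => q j ^+ k.-1) _ j0k) -mulrA.
  rewrite dvdp_mull // -big_split /=; apply: dvdp_prod => j _.
  set l := swap_out k j0 j.
  have lk : (l <= k)%N by rewrite /l /swap_out; case: ifP => // _; apply: ltnW.
  have gk : (g j <= k.-1)%N by have := ltn_ord (g j); lia.
  rewrite -(subnK gk) exprD -mulrA dvdp_mull //.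
  by apply: log_dvd_derivn; apply: log_dvdZ (b0 _ lk) _; apply: log_dvd_exp.
pose m := [arg max_(j > ord0 : 'I_k.+1) pdeg (q j)].
have mP (j : 'I_k.+1) : (pdeg (q j) <= pdeg (q m))%N.
  by rewrite /m; case: arg_maxnP => // i _; apply.
have mk : (m <= k)%N by rewrite -ltnS.
have := coprime_relation_pdeg FT hsize h0 hsum hind hcop R0 Rdvd mk.
rewrite /h pdegZ ?b0 // pdegX ?q0 //.
have : (pdeg R <= k.-1 * (k.+1 * pdeg (q m)))%N.
  rewrite /R pdeg_prod; last by move=> j _; rewrite expf_neq0 ?q0 // -ltnS.
  apply: (@leq_trans (\sum_(j < k.+1) pdeg (q m) * k.-1)).
    apply: leq_sum => j _; rewrite pdegX; first by rewrite leq_mul2r mP orbT.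
    by apply: q0; rewrite -ltnS.
  by rewrite sum_nat_const card_ord; move: (pdeg _); nia.
have k2 : (k ^ 2 <= d + 1)%N.
  by apply: leq_trans rd; rewrite leq_sqr; lia.
(* With M the largest degree, the bound reads d M + k (k - 1) / 2 <= (k^2 - 1) M, and k^2 - 1 <= d.
   For k >= 2 the middle term is positive, a contradiction. For k = 1 it gives M = 0: both quotients
   are constants and the two bases are proportional. For k = 0 the single member would be zero. *)
case: (ltngtP k 1) => k1.
- have k0 : k = 0%N by lia.
  by case/eqP: (h0 0%N isT); move: hsum; rewrite k0 big_ord1.
- have : (0 < \sum_(j < k) j)%N by rewrite (bigD1 (Ordinal k1)).
  move: (\sum_(j < k) j)%N (pdeg R) (pdeg _) => A B C.
  have : (k.-1 * k.+1 <= d)%N by case: (k) k2 => // k' /=; nia.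
  by move: (k.-1) => k'; nia.
move=> leR le0; have m0 : pdeg (q m) = 0%N.
  move: leR le0; rewrite [in k.-1]k1 /=; move: (pdeg R) (\sum_(j < k) j)%N (pdeg _).
  by move=> A B C; nia.
have qc j : (j <= 1)%N -> exists2 z, z != 0 & q j = z%:P.
  rewrite -k1 => jk; have jk1 : (j < k.+1)%N by [].
  have /pdeg_eq0P qE : pdeg (q j) = 0%N.
    by have := mP (Ordinal jk1); rewrite m0 /= leqn0 => /eqP.
  by exists (q j)`_0 => //; move: (q0 j jk); rewrite {1}qE polyC_eq0.
have [z0 z00 ez0] := qc 0%N isT; have [z1 z10 ez1] := qc 1%N isT.
have k1' : (1 <= k)%N by rewrite k1.
case: (nprop (e 0%N) (e 1%N) (z0 / z1)); try exact: es.
  by apply/eqP => /einj => /(_ isT k1').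
by rewrite fq // fq // ez0 ez1 !mul_polyC scalerA divfK.
Qed.

End PowerIndependence.

(** * Products of powers of distinct linear factors *)

Section ShiftedMonomials.

Variables (F : fieldType) (n : nat) (b : 'I_n -> F).
Hypothesis b_inj : injective b.

Definition shifted_monomial (u : 'I_n -> nat) : {poly F} :=
  \prod_(a < n) ('X - (b a)%:P) ^+ u a.

Lemma shifted_monomial_neq0 u : shifted_monomial u != 0.
Proof. by apply/prodf_neq0 => a _; rewrite expf_neq0 // polyXsubC_eq0. Qed.

Lemma shifted_monomialD u v :
  shifted_monomial (fun a => u a + v a)%N =
  shifted_monomial u * shifted_monomial v.
Proof. by rewrite -big_split; apply: eq_bigr => a _; rewrite exprD. Qed.

Lemma pdeg_shifted_monomial u : pdeg (shifted_monomial u) = (\sum_(a < n) u a)%N.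
Proof.
rewrite pdeg_prod => [|a _]; last by rewrite expf_neq0 // polyXsubC_eq0.
by apply: eq_bigr => a _; rewrite /pdeg size_exp_XsubC.
Qed.

Lemma coprimep_shifted_monomial p u :
  (forall a, coprimep p ('X - (b a)%:P)) -> coprimep p (shifted_monomial u).
Proof.
move=> cop; rewrite /shifted_monomial; elim/big_ind: _ => [|q r cq cr|a _].
- exact: coprimep1.
- by rewrite coprimepMr cq.
- exact/coprimep_expr/cop.
Qed.

Lemma shifted_monomial_coprime_XsubC u a :
  u a = 0%N -> coprimep ('X - (b a)%:P) (shifted_monomial u).
Proof.
move=> ua0; rewrite /shifted_monomial; elim/big_ind: _ => [|q r cq cr|a' _].
- exact: coprimep1.
- by rewrite coprimepMr cq.
have [->|ne] := eqVneq a' a; first by rewrite ua0 coprimep1.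
by apply/coprimep_expr/coprimep_XsubC2; rewrite subr_eq0 (inj_eq b_inj).
Qed.

(** Each linear factor is missing from some member, so the gcd is prime to all linear factors, hence
    to the members that it divides. *)
Lemma big_gcd_shifted_monomial m (u : nat -> 'I_n -> nat) :
    (forall a, exists2 j, (j < m.+1)%N & u j a = 0%N) ->
  \big[@gcdp F/0]_(j < m.+1) shifted_monomial (u j) %| 1.
Proof.
move=> u0; set G := \big[_/_]_(_ < _) _.
have GM j : (j < m.+1)%N -> G %| shifted_monomial (u j).
  by move=> jm; apply: (big_gcd_dvdp (fun j => shifted_monomial (u j))).
suff : coprimep G (shifted_monomial (u 0%N)).
  by rewrite dvdp1 size_poly_eq1 => /coprimepP; apply; rewrite ?GM.
apply: coprimep_shifted_monomial => a; have [j jm uj] := u0 a.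
rewrite coprimep_sym; apply: coprimep_dvdl (GM j jm) _.
exact: shifted_monomial_coprime_XsubC.
Qed.

Variables (T : nat) (I : eqType) (u : I -> 'I_n -> nat).
Hypothesis FT : small_nat_neq0 F T.

(* In a minimal relation, after the common factor is removed, every exponent
   is at most [n.-1] times the number of derivations in the Wronskian. *)
Lemma shifted_monomial_relation (s : seq I) (c : I -> F) x :
    (forall i, i \in s -> (size (shifted_monomial (u i)) <= T.+1)%N) ->
    uniq s -> x \in s -> c x != 0 ->
    \sum_(i <- s) c i *: shifted_monomial (u i) = 0 ->
  exists k (e : nat -> I) (c' : nat -> F),
    [/\ forall j, (j <= k)%N -> e j \in s,
        forall j l, (j <= k)%N -> (l <= k)%N -> e j = e l -> j = l,
        forall j, (j <= k)%N -> c' j != 0,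
        \sum_(j < k.+1) c' j *: shifted_monomial (u (e j)) = 0 &
        forall j l a, (j <= k)%N -> (l <= k)%N ->
          (u (e j) a - u (e l) a <= (n - 1) * \sum_(i < (size s).-1) i)%N].
Proof.
move=> usz us xs cx sum0.
have [k [e [d [ks [es einj d0 dsum dind]]]]] :=
  @minimal_relation F I (fun i => shifted_monomial (u i)) s c x us sum0 xs cx.
exists k, e, d; split=> //.
(* [mu] is the minimum of the exponents, factor by factor, so [M] is the common factor of the
   members; for each [a], member [jm a] has no factor of index [a] left after the division. *)
pose jm a := [arg min_(j < ord0 : 'I_k.+1) u (e j) a].
pose mu a := u (e (jm a)) a.
have muP j a : (j <= k)%N -> (mu a <= u (e j) a)%N.
  move=> jk; rewrite /mu /jm; case: arg_minnP => // i _.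
  by move=> /(_ (@Ordinal k.+1 j jk) isT).
pose v j a := (u (e j) a - mu a)%N.
pose M := shifted_monomial mu.
have M0 : M != 0 by apply: shifted_monomial_neq0.
pose h j := d j *: shifted_monomial (v j).
have hM j : (j <= k)%N -> d j *: shifted_monomial (u (e j)) = h j * M.
  move=> jk; rewrite /h -scalerAl -shifted_monomialD; congr (_ *: _).
  by apply: eq_bigr => a _; rewrite subnK // muP.
have h0 j : (j <= k)%N -> h j != 0.
  by move=> jk; rewrite scaler_eq0 negb_or d0 //= shifted_monomial_neq0.
have hsum : \sum_(j < k.+1) h j = 0.
  apply: (mulIf M0); rewrite mul0r mulr_suml -[RHS]dsum; apply: eq_bigr => j _.
  by rewrite hM // -ltnS.
have hind : lin_indep k h.
  move=> a asum; apply: dind.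
  transitivity ((\sum_(j < k) a j *: h j) * M); last by rewrite asum mul0r.
  rewrite mulr_suml; apply: eq_bigr => j _; rewrite -scalerAl hM //; exact: ltnW.
have hsize j : (j <= k)%N -> (size (h j) <= T.+1)%N.
  move=> jk; apply: leq_trans (usz _ (es j jk)).
  have -> : size (h j) = size (shifted_monomial (v j)) by rewrite size_scale ?d0.
  apply: dvdp_leq; first exact: shifted_monomial_neq0.
  by rewrite -(@dvdpZr _ (d j)) ?d0 // hM // /h -scalerAl dvdpZr ?d0 // dvdp_mulr.
have hcop : \big[@gcdp F/0]_(j < k.+1) h j %| 1.
  have vcop : \big[@gcdp F/0]_(j < k.+1) shifted_monomial (v j) %| 1.
    by apply: big_gcd_shifted_monomial => a; exists (jm a); rewrite /v ?subnn.
  apply: dvdp_trans vcop; rewrite -[X in _ %| X]mulr1.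
  apply: (@dvdp_big_gcd F k.+1 (fun j => shifted_monomial (v j))) => j jk.
  by rewrite mulr1; apply: dvdp_trans (big_gcd_dvdp h jk) _; rewrite dvdpZl ?d0.
(* One power of [rho] pays for one derivation of any product of these linear factors. A term of the
   Wronskian contains [L] derivations, so [R] is [rho ^+ L], of degree n L; subtracting the [L]
   gained on the left leaves (n - 1) L. *)
pose rho := \prod_(a < n) ('X - (b a)%:P).
have rho0 : rho != 0 by apply/prodf_neq0 => a _; rewrite polyXsubC_eq0.
set L := (\sum_(j < k) j)%N.
have Rdvd j0 (g : 'S_k) : (j0 <= k)%N ->
    \prod_(j < k) h (swap_out k j0 j) %|
    rho ^+ L * \prod_(j < k) (h (swap_out k j0 j))^`(g j).
  move=> j0k.
  have -> : L = (\sum_(j < k) g j)%N by rewrite /L (reindex_inj (@perm_inj _ g)).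
  rewrite expr_sum -big_split /=; apply: dvdp_prod => j _.
  have lk : (swap_out k j0 j <= k)%N.
    by rewrite /swap_out; case: ifP => // _; apply: ltnW.
  apply: log_dvd_derivn; apply: log_dvdZ (d0 _ lk) _.
  by apply: log_dvd_prod => a; apply: log_dvd_exp.
move=> j l a jk lk.
have := coprime_relation_pdeg FT hsize h0 hsum hind hcop (expf_neq0 L rho0) Rdvd jk.
have -> : pdeg (rho ^+ L) = (n * L)%N.
  rewrite pdegX // pdeg_prod => [|a' _]; last by rewrite polyXsubC_eq0.
  under eq_bigr do rewrite /pdeg size_XsubC.
  by rewrite sum_nat_const card_ord muln1.
rewrite pdegZ ?d0 // pdeg_shifted_monomial (bigD1 a) //= -/L.
have leL : (L <= \sum_(i < (size s).-1) i)%N.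
  have ks' : (k <= (size s).-1)%N by lia.
  rewrite /L -!(big_mkord xpredT id) (big_cat_nat (leq0n k) ks') /=; exact: leq_addr.
move: leL; move: (\sum_(i < (size s).-1) i)%N (\sum_(i | i != a) _)%N => A B leL le.
have ml := muP l a lk; rewrite /v in le.
have n0 : (0 < n)%N by apply: leq_ltn_trans (ltn_ord a).
by have : ((n - 1) * L <= (n - 1) * A)%N; [rewrite leq_mul2l leL orbT|nia].
Qed.

End ShiftedMonomials.

(** * Restriction to a curve *)

(** Powers of proportional polynomials are merged by (z h)^d = z^d h^d and zero polynomials are
    dropped, which produces the pairwise non-proportional bases that [power_lin_indep] asks for. *)
Lemma collect_powers (F : fieldType) n d (l : seq (F * {mpoly F[n]})) :
    (0 < d)%N ->
  exists (gs : seq {mpoly F[n]}) (c : {mpoly F[n]} -> F),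
  [/\ uniq gs, (size gs <= size l)%N,
      forall g, g \in gs -> g != 0 /\ g \in [seq x.2 | x <- l],
      forall g h a, g \in gs -> h \in gs -> g != h -> g <> a *: h &
      \sum_(x <- l) x.1 *: x.2 ^+ d = \sum_(g <- gs) c g *: g ^+ d].
Proof.
move=> d0; elim: l => [|[a g] l [gs [c [ugs szgs gs0 np e]]]].
  by exists [::], (fun=> 0); rewrite !big_nil.
have gs0' h : h \in gs -> h != 0 /\ h \in [seq x.2 | x <- (a, g) :: l].
  by move=> /gs0 [? ?]; rewrite inE; split=> //; apply/orP; right.
have [g0|g0] := eqVneq g 0.
  exists gs, c; split=> //; first exact: leqW.
  by rewrite big_cons /= g0 expr0n eqn0Ngt d0 scaler0 add0r.
case: (classic (exists2 h, h \in gs & exists z, g = z *: h)) => [[h hgs [z gE]]|nex].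
  exists gs, (fun g' => if g' == h then a * z ^+ d + c h else c g').
  split=> //; first exact: leqW.
  rewrite big_cons /= e (bigD1_seq h) //= [in RHS](bigD1_seq h) //= eqxx.
  rewrite gE exprZn scalerA scalerDl -addrA; congr (_ + (_ + _)).
  by apply: eq_bigr => g' /negPf ->.
have ggs : g \notin gs by apply/negP => gin; apply: nex; exists g => //; exists 1; rewrite scale1r.
exists (g :: gs), (fun g' => if g' == g then a else c g'); split.
- by rewrite /= ggs.
- by rewrite /= ltnS.
- by move=> h; rewrite inE => /predU1P[->|/gs0' //]; rewrite inE eqxx.
- move=> g1 g2 z; rewrite !inE => /predU1P[->|h1] /predU1P[->|h2].
  + by rewrite eqxx.
  + by move=> _ ge; apply: nex; exists g2 => //; exists z.
  + move=> _ ge; apply: nex; exists g1 => //; exists z^-1.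
    have z0 : z != 0.
      by case: (gs0 _ h1) => + _; rewrite ge; apply: contraNneq => ->; rewrite scale0r.
    by rewrite ge scalerA mulVf // scale1r.
  + exact: np.
rewrite !big_cons /= eqxx e; congr (_ + _).
rewrite big_seq_cond [in RHS]big_seq_cond; apply: eq_bigr => g' /andP[g'in _].
by case: eqP => // ge; move: ggs; rewrite -ge g'in.
Qed.

Section Curve.

Variables (F : fieldType) (n' i : nat).
Let n := n'.+1.
Variable b : 'I_n -> F.
Hypothesis b_inj : injective b.
Hypothesis i_gt0 : (0 < i)%N.

Definition curve_weight (a : 'I_n) : nat := if a == ord0 then 1%N else i.

Definition curve (a : 'I_n) : {poly F} := ('X - (b a)%:P) ^+ curve_weight a.

Definition restrict (f : {mpoly F[n]}) : {poly F} := mmap polyC curve f.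

Lemma restrictD f g : restrict (f + g) = restrict f + restrict g.
Proof. exact: mmapD. Qed.

Lemma restrictZ c f : restrict (c *: f) = c *: restrict f.
Proof. by rewrite /restrict mmapZ mul_polyC. Qed.

Lemma restrictX f d : restrict (f ^+ d) = restrict f ^+ d.
Proof. by rewrite /restrict rmorphXn. Qed.

Lemma restrict_sum (J : Type) (s : seq J) (f : J -> {mpoly F[n]}) :
  restrict (\sum_(x <- s) f x) = \sum_(x <- s) restrict (f x).
Proof. exact: raddf_sum. Qed.

Definition curve_exponent (m : 'X_{1..n}) (a : 'I_n) := (curve_weight a * m a)%N.

Lemma restrictE f : restrict f =
  \sum_(m <- msupp f) f@_m *: shifted_monomial b (curve_exponent m).
Proof.
rewrite /restrict /mmap; apply: eq_bigr => m _; rewrite mul_polyC; congr (_ *: _).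
by apply: eq_bigr => a _; rewrite /curve -exprM.
Qed.

Lemma size_curve_monomial (f : {mpoly F[n]}) delta m :
    m \in msupp f -> (msize f <= delta.+1)%N ->
  (size (shifted_monomial b (curve_exponent m)) <= (delta * i).+1)%N.
Proof.
move=> mf szf.
have := pdeg_shifted_monomial b (curve_exponent m).
have mdeg_le : (mdeg m <= delta)%N by have := msize_mdeg_lt mf; lia.
have : (\sum_(a < n) curve_exponent m a <= mdeg m * i)%N.
  rewrite mdegE big_distrl /=; apply: leq_sum => a _.
  by rewrite /curve_exponent /curve_weight mulnC leq_mul2l; case: ifP; rewrite ?i_gt0 ?leqnn ?orbT.
rewrite /pdeg; move: (size _) (\sum_(a < n) _)%N => A B; nia.
Qed.

Lemma size_restrict f delta :
  (msize f <= delta.+1)%N -> (size (restrict f) <= (delta * i).+1)%N.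
Proof.
move=> szf; rewrite restrictE big_seq.
apply: (big_ind (fun p : {poly F} => size p <= (delta * i).+1)%N).
- by rewrite size_poly0.
- by move=> p q hp hq; apply: leq_trans (size_polyD _ _) _; rewrite geq_max hp.
move=> m mf; apply: leq_trans (size_scale_leq _ _) _.
exact: size_curve_monomial mf szf.
Qed.

(** If the restriction were zero, a minimal relation among the monomials of [f] on the curve would
    have exponents outside coordinate 0 that are multiples of [i] differing by less than [i], hence
    equal. Its members would be a common factor [K] times distinct powers of a single linear factor,
    and these are independent. *)
Lemma restrict_sparse_eq0 f delta t :
    small_nat_neq0 F (delta * i) -> (msize f <= delta.+1)%N -> sparse t f ->
    (n' * \sum_(j < t.-1) j < i)%N ->
  restrict f = 0 -> f = 0.
Proof.
move=> FT szf spf lti rf0; apply/eqP/negPn/negP => f0.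
have [x xf] : exists x, x \in msupp f.
  exists (mlead f); exact: mlead_supp.
have usz m : m \in msupp f ->
    (size (shifted_monomial b (curve_exponent m)) <= (delta * i).+1)%N.
  by move=> mf; apply: size_curve_monomial mf szf.
have fx : f@_x != 0 by rewrite -mcoeff_msupp.
have rsum : \sum_(m <- msupp f) f@_m *: shifted_monomial b (curve_exponent m) = 0.
  by rewrite -restrictE.
have [k [e [c [es einj c0 csum dist]]]] :=
    @shifted_monomial_relation F n b b_inj (delta * i)%N _ curve_exponent FT
      (msupp f) (fun m => f@_m) x usz (msupp_uniq f) xf fx rsum.
have agree j l a : (j <= k)%N -> (l <= k)%N -> a != ord0 -> (e j a <= e l a)%N.
  move=> jk lk a0; have := dist j l a jk lk.
  rewrite /curve_exponent /curve_weight (negPf a0) -mulnBr subn1 /= => le.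
  have : (\sum_(j < (size (msupp f)).-1) j <= \sum_(j < t.-1) j)%N.
    have st : ((size (msupp f)).-1 <= t.-1)%N by move: spf; rewrite /sparse; lia.
    by rewrite -!(big_mkord xpredT id) (big_cat_nat (leq0n _) st) /= leq_addr.
  move: le lti; move: (\sum_(_ < _) _)%N (\sum_(_ < _) _)%N => A B.
  move=> le1 le2 le3; rewrite leqNgt; apply/negP => lt.
  have : (i * 1 <= i * (e j a - e l a))%N by rewrite leq_mul2l subn_gt0 lt orbT.
  by nia.
pose K := \prod_(a < n | a != ord0) ('X - (b a)%:P) ^+ curve_exponent (e 0%N) a.
have K0 : K != 0 by apply/prodf_neq0 => a _; rewrite expf_neq0 // polyXsubC_eq0.
have ME j : (j <= k)%N -> shifted_monomial b (curve_exponent (e j)) =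
    ('X - (b ord0)%:P) ^+ e j ord0 * K.
  move=> jk; rewrite /shifted_monomial (bigD1 ord0) //=; congr (_ * _).
    by rewrite /curve_exponent /curve_weight eqxx mul1n.
  apply: eq_bigr => a a0; rewrite /curve_exponent; congr (_ ^+ (_ * _)).
  by apply/eqP; rewrite eqn_leq !agree.
have : \sum_(j < k.+1) c j *: ('X - (b ord0)%:P) ^+ e j ord0 = 0.
  apply: (mulIf K0); rewrite mul0r mulr_suml -[RHS]csum; apply: eq_bigr => j _.
  by rewrite ME -?scalerAl // -ltnS.
(* The translation turns powers of X - b_0 into powers of X, and the coefficient at the exponent of
   member 0 isolates [c 0]. *)
move=> /(congr1 (fun p => p \Po ('X + (b ord0)%:P))).
rewrite comp_poly0 raddf_sum /= => /(congr1 (fun p : {poly F} => p`_(e 0%N ord0))).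
rewrite coef0 coef_sum (bigD1 ord0) //= big1 => [|j j0].
  rewrite addr0 comp_polyZ rmorphXn /= raddfB /= comp_polyX comp_polyC addrK.
  by rewrite coefZ coefXn eqxx mulr1 => /eqP; apply/negP/c0.
rewrite comp_polyZ rmorphXn /= raddfB /= comp_polyX comp_polyC addrK.
rewrite coefZ coefXn; case: eqP => [eq0|_]; last by rewrite mulr0.
have jk : (j <= k)%N by rewrite -ltnS.
case/eqP: j0; apply: val_inj; apply: einj => //=.
apply/mnmP => a; have [->//|a0] := eqVneq a ord0.
by apply/eqP; rewrite eqn_leq !agree.
Qed.

End Curve.

Lemma sum_ltn_bound m : ((\sum_(j < m) j) * 2 <= m * (m - 1))%N.
Proof.
elim: m => [|m IHm]; first by rewrite big_ord0.
by rewrite big_ord_recr /=; move: (\sum_(_ < _) _)%N IHm => A; nia.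
Qed.

Lemma sparseD (F : fieldType) n s t (f g : {mpoly F[n]}) :
  sparse s f -> sparse t g -> sparse (s + t) (f + g).
Proof.
rewrite /sparse => sf sg; apply: (@leq_trans (size (msupp f ++ msupp g))).
  by apply: uniq_leq_size; [exact: msupp_uniq|exact: msuppD_le].
by rewrite size_cat leq_add.
Qed.

Lemma sparseZ (F : fieldType) n s c (f : {mpoly F[n]}) :
  sparse s f -> sparse s (c *: f).
Proof.
rewrite /sparse => sf; apply: leq_trans sf.
by apply: uniq_leq_size; [exact: msupp_uniq|exact: msuppZ_le].
Qed.

(** If two collected bases g1, g2 satisfied g1 = a g2 on the curve, then g1 - a g2, which is
    2s-sparse, would restrict to zero and so be zero. The restricted bases thus stay pairwise
    non-proportional, their d-th powers are independent, and a zero restriction makes all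
    coefficients of [f] in the collected powers vanish. *)
Lemma sum_pow_sparse_restrict (F : fieldType) n' r s d delta (b : 'I_n'.+1 -> F)
    (f : {mpoly F[n'.+1]}) (i := (r * s ^ 2 * n'.+1)%N) :
    injective b -> (0 < r)%N -> (0 < s)%N -> (0 < d)%N -> (0 < delta)%N ->
    ((r - 1) ^ 2 <= d + 1)%N -> small_nat_neq0 F (d * delta * i) ->
    f != 0 -> sum_pow_sparse r d s delta f ->
  restrict i b f != 0 /\ (size (restrict i b f) <= (d * delta * i).+1)%N.
Proof.
move=> binj r0 s0 d0 delta0 rd FT f0 [al [g [gs fE]]].
have i0 : (0 < i)%N by rewrite /i !muln_gt0 r0 s0.
have FT' : small_nat_neq0 F (delta * i) by move=> m mT; apply: FT; nia.
have powsz h : (msize h <= delta.+1)%N ->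
    (size (restrict i b h ^+ d) <= (d * delta * i).+1)%N.
  move=> hsz; have := size_restrict b i0 hsz; set q := restrict _ _ _.
  have := size_exp q d; move: (size (q ^+ d)) (size q) => A B; nia.
split; last first.
  rewrite fE restrict_sum; apply: (big_ind (fun p : {poly F} => size p <= (d * delta * i).+1)%N).
  - by rewrite size_poly0.
  - by move=> p q hp hq; apply: leq_trans (size_polyD _ _) _; rewrite geq_max hp.
  move=> j _; rewrite restrictZ restrictX; apply: leq_trans (size_scale_leq _ _) _.
  exact: powsz (gs j).2.
have [hs [c [uhs szhs hs0 np hE]]] :=
  collect_powers [seq (al j, g j) | j <- index_enum 'I_r] d0.
have szr : (size hs <= r)%N.
  by apply: leq_trans szhs _; rewrite size_map /index_enum -enumT size_enum_ord.
have fhs : f = \sum_(h <- hs) c h *: h ^+ d by rewrite -hE big_map.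
have good h : h \in hs -> sparse s h /\ (msize h <= delta.+1)%N.
  by move=> /hs0 [_] /mapP [x /mapP [j _ ->] ->]; apply: gs.
have bnd : (n' * \sum_(j < s.-1) j < i)%N.
  have := sum_ltn_bound s.-1; rewrite /i; move: (\sum_(_ < _) _)%N => A.
  by case: s s0 {gs i FT FT' powsz good i0} => //= s' _; nia.
have nz h : h \in hs -> restrict i b h != 0.
  move=> hin; case: (good h hin) => sp sz; case: (hs0 h hin) => + _.
  apply: contra_neq; exact: (restrict_sparse_eq0 binj i0 FT' sz sp bnd).
apply/eqP => rf0; case/eqP: f0; rewrite fhs big_seq big1 // => h hin.
have -> : c h = 0; last by rewrite scale0r.
apply: (@power_lin_indep F _ (restrict i b) hs r d (d * delta * i)%N c) hin => //.
- by move=> h' h'in; split; [exact: nz|exact: powsz (good _ h'in).2].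
- move=> g1 g2 a h1 h2 ne e12; apply: (np g1 g2 a) => //.
  (* Two distinct bases exist only for r >= 2; this supplies the factor 2 in [i] needed for [s + s]
     monomials. *)
  have r2 : (2 <= r)%N.
    apply: leq_trans szr; have : {subset [:: g1; g2] <= hs}.
      by move=> x; rewrite !inE => /orP[/eqP->|/eqP->].
    by move=> sub; apply: (uniq_leq_size _ sub); rewrite /= inE ne.
  apply/eqP; rewrite -subr_eq0 -scaleNr; apply/eqP.
  have [[sp1 sz1] [sp2 sz2]] := (good _ h1, good _ h2).
  apply: (@restrict_sparse_eq0 F n' i b binj i0 _ delta (s + s)) => //.
  - apply: leq_trans (msizeD_le _ _) _; rewrite geq_max sz1.
    exact: leq_trans (msizeZ_le _ _) sz2.
  - exact/sparseD/sparseZ.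
  - have := sum_ltn_bound (s + s).-1; rewrite /i; move: (\sum_(_ < _) _)%N => A.
    by case: s s0 {gs i FT FT' powsz good i0 nz bnd rf0 e12 sp1 sp2} => //= s' _; nia.
  - by rewrite restrictD restrictZ e12 scaleNr subrr.
- by rewrite -[RHS]rf0 fhs restrict_sum; apply: eq_bigr => h' _; rewrite restrictZ restrictX.
Qed.

(** * Polynomial-time programs *)

(** Naturals are unary, so they count with their value; field elements are free and every list cell
    counts one. *)
Fixpoint tsize (F : fieldType) (A : ty) : den F A -> nat :=
  match A return den F A -> nat with
  | TNat => fun m => m
  | TFld => fun _ => 0%N
  | TProd A B => fun x => (tsize x.1 + tsize x.2)%N
  | TList A => fun l => sumn [seq (tsize x).+1 | x <- l]
  end.

Fixpoint esize (F : fieldType) (G : seq ty) : env F G -> nat :=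
  match G return env F G -> nat with
  | [::] => fun _ => 0%N
  | A :: G => fun e => (tsize e.1 + esize e.2)%N
  end.

(** The base is at least 2, so a single exponent absorbs constant factors and summands. *)
Definition poly_bounded G (phi : forall F, env F G -> nat) : Prop :=
  exists c, forall F e, (phi F e <= (esize e).+2 ^ c)%N.

(** The bound on the size of the result makes the notion closed under composition: the second stage
    is charged by the size of what the first one returns. One term and one exponent serve all
    fields. *)
Definition polytime G A (f : forall F, env F G -> den F A) : Prop :=
  exists t : tm G A, [/\ forall F e, eval t e = f F e,
    poly_bounded (fun F (e : env F G) => cost t e) &
    poly_bounded (fun F e => tsize (f F e))].

Section PolyBounded.

Variable G : seq ty.
Implicit Types phi psi : forall F, env F G -> nat.

Lemma poly_bounded_le phi psi :
  (forall F e, (phi F e <= psi F e)%N) -> poly_bounded psi -> poly_bounded phi.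
Proof. by move=> le [c pc]; exists c => F e; apply: leq_trans (pc F e). Qed.

Lemma poly_bounded_const k : poly_bounded (fun F (_ : env F G) => k).
Proof.
exists k => F e; apply: leq_trans (ltnW (ltn_expl k (ltnSn 1))) _.
by case: k => // k; rewrite leq_exp2r.
Qed.

Lemma poly_bounded_esize : poly_bounded (fun F (e : env F G) => esize e).
Proof. by exists 1%N => F e; rewrite expn1 ltnW // ltnW. Qed.

Lemma poly_boundedM phi psi : poly_bounded phi -> poly_bounded psi ->
  poly_bounded (fun F e => phi F e * psi F e)%N.
Proof. by move=> [a ha] [b hb]; exists (a + b)%N => F e; rewrite expnD leq_mul. Qed.

Lemma poly_boundedD phi psi : poly_bounded phi -> poly_bounded psi ->
  poly_bounded (fun F e => phi F e + psi F e)%N.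
Proof.
move=> [a ha] [b hb]; exists (a + b).+1 => F e.
have X1 : (0 < (esize e).+2)%N by [].
rewrite expnS mulSn; apply: (@leq_trans ((esize e).+2 ^ (a + b) * 2)).
  rewrite muln2 -addnn leq_add //.
    by apply: leq_trans (ha F e) _; rewrite leq_pexp2l ?leq_addr.
  by apply: leq_trans (hb F e) _; rewrite leq_pexp2l ?leq_addl.
by rewrite mulnC -mulSn leq_mul2r ltnS ltnS leq0n orbT.
Qed.

Lemma poly_boundedS phi : poly_bounded phi ->
  poly_bounded (fun F e => (phi F e).+1).
Proof.
move=> h; apply: poly_bounded_le (poly_boundedD h (poly_bounded_const 1)) => F e.
by rewrite addn1.
Qed.

Lemma poly_boundedX phi c : poly_bounded phi ->
  poly_bounded (fun F e => phi F e ^ c)%N.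
Proof.
move=> h; elim: c => [|c IHc]; first exact: poly_bounded_const.
by apply: poly_bounded_le (poly_boundedM h IHc) => F e; rewrite expnS.
Qed.

Lemma poly_bounded_subst G' (chi : forall F, env F G' -> nat)
    (rho : forall F, env F G -> env F G') psi :
    poly_bounded chi -> (forall F e, (esize (rho F e) <= psi F e)%N) ->
  poly_bounded psi -> poly_bounded (fun F e => chi F (rho F e)).
Proof.
move=> [c hc] le hpsi; apply: poly_bounded_le (poly_boundedX c (poly_boundedS (poly_boundedS hpsi))).
by move=> F e; apply: leq_trans (hc _ _) _; case: (c) => // c'; rewrite leq_exp2r // !ltnS.
Qed.

End PolyBounded.

(** * Renaming of variables *)

Definition ren G G' := forall A, var G A -> var G' A.

(** The match returns a function of [r], so that the type of [r] is refined along with the context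
    of [v]. *)
Definition lift_ren G G' (r : ren G G') C : ren (C :: G) (C :: G') :=
  fun A v =>
  match v in var D A return
    (if D is C' :: D' then ren D' G' -> var (C' :: G') A else unit) with
  | VZ _ _ => fun _ => VZ _ _
  | VS _ _ _ v => fun r => VS _ (r _ v)
  end r.

Arguments lift_ren [G G'] r C A v.

Fixpoint rename G A (t : tm G A) : forall G', ren G G' -> tm G' A :=
  match t in tm G A return forall G', ren G G' -> tm G' A with
  | Var _ _ v => fun _ r => Var (r _ v)
  | Let _ _ _ t u => fun _ r => Let (rename t r) (rename u (lift_ren r _))
  | Pair _ _ _ t u => fun _ r => Pair (rename t r) (rename u r)
  | Fst _ _ _ t => fun _ r => Fst (rename t r)
  | Snd _ _ _ t => fun _ r => Snd (rename t r)
  | Zero _ => fun _ _ => Zero _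
  | Succ _ t => fun _ r => Succ (rename t r)
  | NatCase _ _ t u w => fun _ r =>
      NatCase (rename t r) (rename u r) (rename w (lift_ren r _))
  | NatRec _ _ t u w => fun _ r =>
      NatRec (rename t r) (rename u r) (rename w (lift_ren (lift_ren r _) _))
  | Nil _ _ => fun _ _ => Nil _ _
  | Cons _ _ t u => fun _ r => Cons (rename t r) (rename u r)
  | ListCase _ _ _ t u w => fun _ r =>
      ListCase (rename t r) (rename u r) (rename w (lift_ren (lift_ren r _) _))
  | ListRec _ _ _ t u w => fun _ r =>
      ListRec (rename t r) (rename u r) (rename w (lift_ren (lift_ren r _) _))
  | FZero _ => fun _ _ => FZero _
  | FOne _ => fun _ _ => FOne _
  | FAdd _ t u => fun _ r => FAdd (rename t r) (rename u r)
  | FOpp _ t => fun _ r => FOpp (rename t r)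
  | FMul _ t u => fun _ r => FMul (rename t r) (rename u r)
  | FInv _ t => fun _ r => FInv (rename t r)
  | FIfEq _ _ t u v w => fun _ r =>
      FIfEq (rename t r) (rename u r) (rename v r) (rename w r)
  end.

Definition renames F G G' (r : ren G G') (e' : env F G') (e : env F G) :=
  forall A (v : var G A), lookup (r A v) e' = lookup v e.

Lemma renames_lift F G G' (r : ren G G') (e' : env F G') (e : env F G) C
    (x : den F C) :
  renames r e' e -> @renames F (C :: G) (C :: G') (lift_ren r C) (x, e') (x, e).
Proof.
move=> h A v.
refine (match v in var D B return
  match D return var D B -> Prop with
  | [::] => fun=> True
  | C' :: D' => fun v => forall (r : ren D' G') (e : env F D') (x : den F C'),
      renames r e' e ->
      lookup (lift_ren r C' _ v) ((x, e') : env F (C' :: G')) =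
      lookup v ((x, e) : env F (C' :: D'))
  end v with VZ _ _ => _ | VS _ _ _ v => _ end r e x h) => // r0 e0 x0 h0 /=.
exact: h0.
Qed.

Lemma eq_foldr (X B : Type) (f f' : X -> B -> B) b l :
  (forall x y, f x y = f' x y) -> foldr f b l = foldr f' b l.
Proof. by move=> ef; elim: l => //= x l ->. Qed.

Lemma eq_foldr_cost (X B : Type) (f f' : X -> B -> B) (c c' : X -> B -> nat) b l :
    (forall x y, f x y = f' x y) -> (forall x y, c x y = c' x y) ->
  foldr_cost f c b l = foldr_cost f' c' b l.
Proof.
move=> ef ec; elim: l => //= x l ->.
by rewrite ec; congr (c' _ _ + _)%N; apply: eq_foldr.
Qed.

Lemma rename_eval F G A (t : tm G A) G' (r : ren G G') (e' : env F G')
    (e : env F G) :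
  renames r e' e -> eval (rename t r) e' = eval t e.
Proof.
elim: t G' r e' e => //=
  [? ? ? t IHt u IHu|? ? ? t IHt u IHu|? ? ? t IHt|? ? ? t IHt|? t IHt
  |? ? t IHt u IHu w IHw|? ? t IHt u IHu w IHw|? ? t IHt u IHu
  |? ? ? t IHt u IHu w IHw|? ? ? t IHt u IHu w IHw|? t IHt u IHu|? t IHt
  |? t IHt u IHu|? t IHt|? ? t IHt u IHu v IHv w IHw] G' r e' e h;
  rewrite ?(IHt _ r e' e h) ?(IHu _ r e' e h) ?(IHv _ r e' e h) ?(IHw _ r e' e h) //.
- by apply: IHu; apply: renames_lift.
- by case: (eval t e) => // k; apply: IHw; apply: renames_lift.
- by apply: eq_iteri => k x; apply: IHw; do 2!apply: renames_lift.
- by case: (eval t e) => // x l; apply: IHw; do 2!apply: renames_lift.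
- by apply: eq_foldr => // x y; apply: IHw; do 2!apply: renames_lift.
Qed.

Lemma rename_cost F G A (t : tm G A) G' (r : ren G G') (e' : env F G')
    (e : env F G) :
  renames r e' e -> cost (rename t r) e' = cost t e.
Proof.
elim: t G' r e' e => //=
  [? ? ? t IHt u IHu|? ? ? t IHt u IHu|? ? ? t IHt|? ? ? t IHt|? t IHt
  |? ? t IHt u IHu w IHw|G0 A0 t IHt u IHu w IHw|? ? t IHt u IHu
  |? ? ? t IHt u IHu w IHw|? ? ? t IHt u IHu w IHw|? t IHt u IHu|? t IHt
  |? t IHt u IHu|? t IHt|? ? t IHt u IHu v IHv w IHw] G' r e' e h;
  rewrite ?(IHt _ r e' e h) ?(IHu _ r e' e h) ?(IHv _ r e' e h) ?(IHw _ r e' e h)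
    ?(rename_eval t h) ?(rename_eval u h) //; congr (_ + _).+1.
- by apply: IHu; apply: renames_lift.
- by case: (eval t e) => // k; apply: IHw; apply: renames_lift.
- apply: eq_bigr => k _.
  have -> : iteri k (fun j a => eval (rename w (lift_ren (lift_ren r A0) TNat))
      ((j, (a, e')) : env F (TNat :: A0 :: G'))) (eval u e) =
      iteri k (fun j a => eval w ((j, (a, e)) : env F (TNat :: A0 :: G0))) (eval u e).
    by apply: eq_iteri => j x; apply: rename_eval; do 2!apply: renames_lift.
  by apply: IHw; do 2!apply: renames_lift.
- by case: (eval t e) => // x l; apply: IHw; do 2!apply: renames_lift.
- apply: eq_foldr_cost => x y; last by apply: IHw; do 2!apply: renames_lift.
  by apply: rename_eval; do 2!apply: renames_lift.
Qed.

(** * Closure properties of polynomial time *)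

Lemma polytime_ext G A (f f' : forall F, env F G -> den F A) :
  (forall F e, f F e = f' F e) -> polytime f -> polytime f'.
Proof.
move=> ff' [t [h1 h2 [c h3]]]; exists t; split=> //; last exists c; move=> F e.
- by rewrite h1.
- by rewrite -ff'.
Qed.

Lemma polytime_size G A (f : forall F, env F G -> den F A) :
  polytime f -> poly_bounded (fun F e => tsize (f F e)).
Proof. by case=> t []. Qed.

Lemma polytime_rename G G' A (f : forall F, env F G -> den F A) (r : ren G G')
    (rho : forall F, env F G' -> env F G) :
    (forall F e, renames r e (rho F e)) ->
    (forall F e, (esize (rho F e) <= esize e)%N) ->
  polytime f -> polytime (fun F e => f F (rho F e)).
Proof.
move=> hr hs [t [h1 h2 h3]]; exists (rename t r); split.
- by move=> F e; rewrite (rename_eval t (hr F e)).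
- apply: poly_bounded_le (poly_bounded_subst h2 hs (@poly_bounded_esize G')).
  by move=> F e; rewrite (rename_cost t (hr F e)).
- exact: poly_bounded_subst h3 hs (@poly_bounded_esize G').
Qed.

Lemma polytime_wk G A B (f : forall F, env F G -> den F A) :
  polytime f -> polytime (fun F (e : env F (B :: G)) => f F e.2).
Proof.
apply: (polytime_rename (r := fun A v => VS B v)) => // F e.
exact: leq_addl.
Qed.

Lemma polytime_wk1 G A B C (f : forall F, env F (C :: G) -> den F A) :
  polytime f ->
  polytime (fun F (e : env F (C :: B :: G)) => f F (e.1, e.2.2)).
Proof.
move=> pf; refine (@polytime_rename (C :: G) (C :: B :: G) A f
  (lift_ren (fun A v => VS B v) C) (fun F e => (e.1, e.2.2)) _ _ pf) => F e.
  by case: e => x e; apply: renames_lift.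
by rewrite /= leq_add2l leq_addl.
Qed.

Lemma polytime_var0 G A : polytime (fun F (e : env F (A :: G)) => e.1).
Proof.
exists (Var (VZ G A)); split=> //; first exact: poly_bounded_const.
by apply: poly_bounded_le (@poly_bounded_esize _) => F e; apply: leq_addr.
Qed.

Lemma polytime_let G A B (a : forall F, env F G -> den F A)
    (b : forall F, env F (A :: G) -> den F B) :
  polytime a -> polytime b -> polytime (fun F e => b F (a F e, e)).
Proof.
move=> [t [ta tc ts]] [u [ub uc us]]; exists (Let t u); split.
- by move=> F e /=; rewrite ta ub.
- apply: (@poly_bounded_le _ _
    (fun F e => (cost t e + cost u ((a F e, e) : env F (A :: G))).+1)).
    by move=> F e /=; rewrite ta.
  apply/poly_boundedS/poly_boundedD => //.
  apply: (poly_bounded_subst (rho := fun F e => (a F e, e) : env F (A :: G)) uc).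
    by move=> F e /=; apply: leqnn.
  exact: poly_boundedD (@poly_bounded_esize _).
- apply: (poly_bounded_subst (rho := fun F e => (a F e, e) : env F (A :: G)) us).
    by move=> F e /=; apply: leqnn.
  exact: poly_boundedD (@poly_bounded_esize _).
Qed.

Lemma polytime_pair G A B (a : forall F, env F G -> den F A)
    (b : forall F, env F G -> den F B) :
  polytime a -> polytime b ->
  polytime (A := TProd A B) (fun F e => (a F e, b F e)).
Proof.
move=> [t [ta tc ts]] [u [ub uc us]]; exists (Pair t u); split.
- by move=> F e /=; rewrite ta ub.
- exact/poly_boundedS/poly_boundedD.
- exact: poly_boundedD.
Qed.

Lemma polytime_zero G : polytime (A := TNat) (fun F (_ : env F G) => 0%N).
Proof. by exists (Zero G); split=> //; apply: poly_bounded_const. Qed.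

Lemma polytime_succ G (a : forall F, env F G -> den F TNat) :
  polytime a -> polytime (A := TNat) (fun F e => (a F e).+1).
Proof.
move=> [t [ta tc ts]]; exists (Succ t); split; try exact/poly_boundedS.
by move=> F e /=; rewrite ta.
Qed.

Lemma polytime_nil G A : polytime (A := TList A) (fun F (_ : env F G) => [::]).
Proof. by exists (Nil G A); split=> //; apply: poly_bounded_const. Qed.

Lemma polytime_cons G A (a : forall F, env F G -> den F A)
    (b : forall F, env F G -> den F (TList A)) :
  polytime a -> polytime b ->
  polytime (A := TList A) (fun F e => a F e :: b F e).
Proof.
move=> [t [ta tc ts]] [u [ub uc us]]; exists (Cons t u); split.
- by move=> F e /=; rewrite ta ub.
- exact/poly_boundedS/poly_boundedD.
- by apply: poly_bounded_le (poly_boundedS (poly_boundedD ts us)) => F e.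
Qed.

Lemma polytime_f0 G : polytime (A := TFld) (fun F (_ : env F G) => 0 : F).
Proof. by exists (FZero G); split=> //; apply: poly_bounded_const. Qed.

Lemma polytime_f1 G : polytime (A := TFld) (fun F (_ : env F G) => 1 : F).
Proof. by exists (FOne G); split=> //; apply: poly_bounded_const. Qed.

Lemma polytime_fadd G (a b : forall F, env F G -> den F TFld) :
  polytime a -> polytime b ->
  polytime (A := TFld) (fun F e => (a F e : F) + b F e).
Proof.
move=> [t [ta tc ts]] [u [ub uc us]]; exists (FAdd t u); split.
- by move=> F e /=; rewrite ta ub.
- exact/poly_boundedS/poly_boundedD.
- exact: poly_bounded_const.
Qed.

Lemma polytime_fmul G (a b : forall F, env F G -> den F TFld) :
  polytime a -> polytime b ->
  polytime (A := TFld) (fun F e => (a F e : F) * b F e).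
Proof.
move=> [t [ta tc ts]] [u [ub uc us]]; exists (FMul t u); split.
- by move=> F e /=; rewrite ta ub.
- exact/poly_boundedS/poly_boundedD.
- exact: poly_bounded_const.
Qed.

Lemma polytime_fifeq G A (a b : forall F, env F G -> den F TFld)
    (c d : forall F, env F G -> den F A) :
  polytime a -> polytime b -> polytime c -> polytime d ->
  polytime (fun F e => if (a F e : F) == b F e then c F e else d F e).
Proof.
move=> [t [ta tc ts]] [u [ub uc us]] [v [vc vcc vs]] [w [wd wc ws]].
exists (FIfEq t u v w); split.
- by move=> F e /=; rewrite ta ub vc wd.
- apply: poly_bounded_le (poly_boundedS (poly_boundedD (poly_boundedD tc uc)
    (poly_boundedD vcc wc))) => F e /=.
  by rewrite ltnS leq_add2l; case: ifP => _; rewrite ?leq_addr ?leq_addl.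
- apply: poly_bounded_le (poly_boundedD vs ws) => F e /=.
  by case: ifP => _; rewrite ?leq_addr ?leq_addl.
Qed.

Lemma polytime_natcase G A (a : forall F, env F G -> den F TNat)
    (b : forall F, env F G -> den F A)
    (c : forall F, env F (TNat :: G) -> den F A) :
  polytime a -> polytime b -> polytime c ->
  polytime (fun F e => if a F e is k.+1 then c F (k, e) else b F e).
Proof.
move=> [t [ta tc ts]] [u [ub uc us]] [w [wd wc ws]].
pose rho F (e : env F G) : env F (TNat :: G) := ((a F e).-1, e).
have rs : forall F e, (esize (rho F e) <= tsize (a F e) + esize e)%N.
  by move=> F e; rewrite leq_add2r leq_pred.
have rb := poly_boundedD ts (@poly_bounded_esize G).
exists (NatCase t u w); split.
- by move=> F e /=; rewrite ta; case: (a F e).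
- apply: poly_bounded_le (poly_boundedS (poly_boundedD tc
    (poly_boundedD uc (poly_bounded_subst wc rs rb)))) => F e /=.
  rewrite ta ltnS leq_add2l /rho.
  by case: (a F e) => [|k]; rewrite ?leq_addr ?leq_addl.
- apply: poly_bounded_le (poly_boundedD us (poly_bounded_subst ws rs rb)) => F e.
  by rewrite /rho; case: (a F e) => [|k]; rewrite ?leq_addr ?leq_addl.
Qed.

Lemma polytime_listcase G A B (a : forall F, env F G -> den F (TList A))
    (b : forall F, env F G -> den F B)
    (c : forall F, env F (A :: TList A :: G) -> den F B) :
  polytime a -> polytime b -> polytime c ->
  polytime (fun F e => if a F e is x :: l then c F (x, (l, e)) else b F e).
Proof.
move=> [t [ta tc ts]] [u [ub uc us]] [w [wd wc ws]].
have [c1 h1] := wc; have [c2 h2] := ws.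
have rb := poly_boundedS (poly_boundedS (poly_boundedD ts (@poly_bounded_esize G))).
exists (ListCase t u w); split.
- by move=> F e /=; rewrite ta; case: (a F e).
- apply: poly_bounded_le (poly_boundedS (poly_boundedD tc
    (poly_boundedD uc (poly_boundedX c1 rb)))) => F e /=.
  rewrite ta ltnS leq_add2l.
  case: (a F e) => [|x l]; rewrite ?leq_addr //.
  apply: leq_trans (leq_addl _ _); apply: leq_trans (h1 _ _) _.
  by case: (c1) => // c'; rewrite leq_exp2r //= !ltnS addnA leq_add2r addSn.
- apply: poly_bounded_le (poly_boundedD us (poly_boundedX c2 rb)) => F e.
  case: (a F e) => [|x l]; rewrite ?leq_addr //.
  apply: leq_trans (leq_addl _ _); apply: leq_trans (h2 _ _) _.
  by case: (c2) => // c'; rewrite leq_exp2r //= !ltnS addnA leq_add2r addSn.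
Qed.

(** Iterating a polynomial-time body may produce huge values, as repeated squaring does. Hence the
    premise that [psi] bounds every intermediate value; it bounds the cost of each round. *)
Lemma polytime_natrec G A (a : forall F, env F G -> den F TNat)
    (b : forall F, env F G -> den F A)
    (w : forall F, env F (TNat :: A :: G) -> den F A)
    (psi : forall F, env F G -> nat) :
    polytime a -> polytime b -> polytime w -> poly_bounded psi ->
    (forall F e k, (k <= a F e)%N ->
      (tsize (iteri k (fun j x => w F (j, (x, e))) (b F e)) <= psi F e)%N) ->
  polytime (fun F e => iteri (a F e) (fun j x => w F (j, (x, e))) (b F e)).
Proof.
move=> [t [ta tc ts]] [u [ub uc us]] [v [vw vc vs]] hpsi le.
have [c1 h1] := vc.
have rb := poly_boundedS (poly_boundedS
  (poly_boundedD ts (poly_boundedD hpsi (@poly_bounded_esize G)))).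
have evE F (e : env F G) k :
    iteri k (fun j x => eval v ((j, (x, e)) : env F (TNat :: A :: G))) (b F e) =
    iteri k (fun j x => w F (j, (x, e))) (b F e).
  by apply: eq_iteri => j x; rewrite vw.
exists (NatRec t u v); split.
- by move=> F e /=; rewrite ta ub evE.
- apply: poly_bounded_le (poly_boundedS (poly_boundedD (poly_boundedD tc uc)
    (poly_boundedM ts (poly_boundedX c1 rb)))) => F e /=.
  rewrite ta ltnS leq_add2l ub.
  apply: (@leq_trans (\sum_(k < a F e) ((a F e + (psi F e + esize e)).+2 ^ c1)%N)).
    apply: leq_sum => k _; rewrite evE; apply: leq_trans (h1 _ _) _.
    case: (c1) => // c'; rewrite leq_exp2r //= !ltnS.
    by rewrite leq_add ?leq_add2r ?le // ltnW.
  by rewrite sum_nat_const card_ord.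
- by apply: poly_bounded_le hpsi => F e; apply: le.
Qed.

Lemma tsize_cat F A (l1 l2 : den F (TList A)) :
  tsize (A := TList A) (l1 ++ l2) =
  (tsize (A := TList A) l1 + tsize (A := TList A) l2)%N.
Proof. by rewrite /= map_cat sumn_cat. Qed.

(** As for naturals; the recursion runs from the end of the list, so the intermediate values are
    those at the suffixes [l2]. *)
Lemma polytime_listrec G A B (a : forall F, env F G -> den F (TList A))
    (b : forall F, env F G -> den F B)
    (w : forall F, env F (A :: B :: G) -> den F B)
    (psi : forall F, env F G -> nat) :
    polytime a -> polytime b -> polytime w -> poly_bounded psi ->
    (forall F e l1 l2, a F e = l1 ++ l2 ->
      (tsize (foldr (fun x y => w F (x, (y, e))) (b F e) l2) <= psi F e)%N) ->
  polytime (fun F e => foldr (fun x y => w F (x, (y, e))) (b F e) (a F e)).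
Proof.
move=> [t [ta tc ts]] [u [ub uc us]] [v [vw vc vs]] hpsi le.
have [c1 h1] := vc.
have rb := poly_boundedS (poly_boundedS
  (poly_boundedD ts (poly_boundedD hpsi (@poly_bounded_esize G)))).
have evE F (e : env F G) l :
    foldr (fun x y => eval v ((x, (y, e)) : env F (A :: B :: G))) (b F e) l =
    foldr (fun x y => w F (x, (y, e))) (b F e) l.
  by apply: eq_foldr => j x; rewrite vw.
exists (ListRec t u v); split.
- by move=> F e /=; rewrite ta ub evE.
- apply: poly_bounded_le (poly_boundedS (poly_boundedD (poly_boundedD tc uc)
    (poly_boundedM ts (poly_boundedX c1 rb)))) => F e.
  rewrite [cost _ _]/= ta ltnS leq_add2l ub.
  set M := (_ ^ c1)%N.
  suff key l1 l2 : a F e = l1 ++ l2 ->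
     (foldr_cost (fun x y => eval v ((x, (y, e)) : env F (A :: B :: G)))
       (fun x y => cost v ((x, (y, e)) : env F (A :: B :: G))) (b F e) l2
      <= tsize (A := TList A) l2 * M)%N by exact: (key [::]).
  elim: l2 l1 => [|x l2 IH] l1 al; first by rewrite /=.
  rewrite [foldr_cost _ _ _ _]/= [tsize _]/= mulnDl.
  have al' : a F e = rcons l1 x ++ l2 by rewrite cat_rcons.
  apply: leq_add; last exact: IH al'.
  apply: (@leq_trans M); last by rewrite mulSn leq_addr.
  apply: leq_trans (h1 _ _) _; rewrite /M; case: (c1) => // c'; rewrite leq_exp2r //.
  rewrite !ltnS [esize _]/= leq_add //.
    by rewrite al tsize_cat /=; lia.
  by rewrite leq_add2r evE (le _ _ _ _ al').
- by apply: poly_bounded_le hpsi => F e; apply: (le F e [::]).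
Qed.

Lemma polytime_var1 G A B : polytime (fun F (e : env F (B :: A :: G)) => e.2.1).
Proof. exact: (polytime_wk B (@polytime_var0 G A)). Qed.

Lemma polytime_var2 G A B C :
  polytime (fun F (e : env F (C :: B :: A :: G)) => e.2.2.1).
Proof. exact: (polytime_wk C (@polytime_var1 G A B)). Qed.

Lemma polytime_var3 G A B C D :
  polytime (fun F (e : env F (D :: C :: B :: A :: G)) => e.2.2.2.1).
Proof. exact: (polytime_wk D (@polytime_var2 G A B C)). Qed.

Lemma polytime_var4 G A B C D E :
  polytime (fun F (e : env F (E :: D :: C :: B :: A :: G)) => e.2.2.2.2.1).
Proof. exact: (polytime_wk E (@polytime_var3 G A B C D)). Qed.

Lemma polytime_var5 G A B C D E H :
  polytime (fun F (e : env F (H :: E :: D :: C :: B :: A :: G)) => e.2.2.2.2.2.1).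
Proof. exact: (polytime_wk H (@polytime_var4 G A B C D E)). Qed.

Ltac ptvar := first
  [ exact: polytime_var0 | exact: polytime_var1 | exact: polytime_var2
  | exact: polytime_var3 | exact: polytime_var4 | exact: polytime_var5 ].

(** Both arguments are bound to variables beforehand, so it is enough to treat [f] on variables, and
    recursions inside [f] do not evaluate the arguments again. *)
Lemma polytime_app2 G A B C (f : forall F, den F A -> den F B -> den F C)
    (a : forall F, env F G -> den F A) (b : forall F, env F G -> den F B) :
    polytime (fun F (e : env F (A :: B :: G)) => f F e.1 e.2.1) ->
    polytime a -> polytime b ->
  polytime (fun F e => f F (a F e) (b F e)).
Proof.
move=> hf ha hb; have := polytime_let (polytime_wk B ha) hf.
exact: (polytime_let hb).
Qed.

Lemma polytime_pred G (a : forall F, env F G -> den F TNat) :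
  polytime a -> polytime (A := TNat) (fun F e => (a F e).-1).
Proof.
move=> ha; apply: polytime_ext (polytime_natcase ha (polytime_zero G)
  (@polytime_var0 G TNat)) => F e.
by case: (a F e).
Qed.

Lemma polytime_add G (a b : forall F, env F G -> den F TNat) :
  polytime a -> polytime b -> polytime (A := TNat) (fun F e => a F e + b F e)%N.
Proof.
move=> ha hb.
have itE (x : nat) k : iteri k (fun _ (y : nat) => y.+1) x = (x + k)%N.
  by elim: k => [|k /= ->]; rewrite ?addn0 ?addnS.
apply: polytime_ext (@polytime_natrec G TNat b a (fun F e => e.2.1.+1)
  (fun F e => a F e + b F e)%N hb ha _ _ _) => [F e|||F e k kb] /=.
- by rewrite itE.
- by apply: polytime_succ; ptvar.
- exact: poly_boundedD (polytime_size ha) (polytime_size hb).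
- by rewrite itE leq_add2l.
Qed.

Lemma polytime_mul G (a b : forall F, env F G -> den F TNat) :
  polytime a -> polytime b -> polytime (A := TNat) (fun F e => a F e * b F e)%N.
Proof.
apply: (@polytime_app2 G TNat TNat TNat (fun F x y => x * y)%N).
have itE (x : nat) k : iteri k (fun _ (y : nat) => y + x)%N 0%N = (x * k)%N.
  by elim: k => [|k /= ->]; rewrite ?muln0 // mulnS addnC.
apply: polytime_ext (@polytime_natrec (TNat :: TNat :: G) TNat (fun F e => e.2.1) (fun F e => 0%N)
  (fun F e => e.2.1 + e.2.2.1)%N (fun F e => e.1 * e.2.1)%N _ _ _ _ _)
  => [F e|||||F e k kb] /=.
- by rewrite itE.
- by ptvar.
- exact: polytime_zero.
- by apply: polytime_add; ptvar.
- apply: poly_boundedM; [exact: (polytime_size (@polytime_var0 _ TNat))|].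
  exact: (polytime_size (@polytime_var1 _ TNat TNat)).
- by rewrite itE leq_mul2l kb orbT.
Qed.

Lemma polytime_sub G (a b : forall F, env F G -> den F TNat) :
  polytime a -> polytime b -> polytime (A := TNat) (fun F e => a F e - b F e)%N.
Proof.
move=> ha hb.
have itE (x : nat) k : iteri k (fun _ (y : nat) => y.-1) x = (x - k)%N.
  by elim: k => [|k /= ->]; rewrite ?subn0 ?subnS.
apply: polytime_ext (@polytime_natrec G TNat b a (fun F e => e.2.1.-1)
  a hb ha _ _ _) => [F e|||F e k kb] /=.
- by rewrite itE.
- by apply: polytime_pred; ptvar.
- exact: (polytime_size ha).
- by rewrite itE leq_subr.
Qed.

Lemma polytime_ifleq G A (a b : forall F, env F G -> den F TNat)
    (c d : forall F, env F G -> den F A) :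
  polytime a -> polytime b -> polytime c -> polytime d ->
  polytime (fun F e => if (a F e <= b F e)%N then c F e else d F e).
Proof.
move=> ha hb hc hd.
apply: polytime_ext (polytime_natcase (polytime_sub ha hb) hc (polytime_wk TNat hd))
  => F e.
by rewrite /leq; case: (_ - _)%N.
Qed.

Lemma polytime_natr G (a : forall F, env F G -> den F TNat) :
  polytime a -> polytime (A := TFld) (fun F e => (a F e)%:R : F).
Proof.
move=> ha.
have itE (F : fieldType) k : iteri k (fun _ (y : F) => y + 1) 0 = k%:R.
  by elim: k => //= k ->; rewrite -natr1.
apply: polytime_ext (@polytime_natrec G TFld a (fun F e => 0) (fun F e => e.2.1 + 1)
  (fun F e => 0%N) ha _ _ _ _) => [F e||||F e k kb] //=.
- exact: polytime_f0.
- by apply: polytime_fadd; [ptvar|exact: polytime_f1].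
- exact: poly_bounded_const.
Qed.

Lemma leq_tsize_mkseq F A (f : nat -> den F A) m M :
    (forall k, (k < m)%N -> (tsize (f k) <= M)%N) ->
  (tsize (A := TList A) (mkseq f m) <= m * M.+1)%N.
Proof.
move=> fM; rewrite /= sumnE /mkseq !big_map.
rewrite -[X in (_ <= X * _)%N](size_iota 0 m) -sum1_size big_distrl /=.
rewrite big_seq [X in (_ <= X)%N]big_seq; apply: leq_sum => k.
by rewrite mem_iota add0n mul1n ltnS => /andP[_]; apply: fM.
Qed.

Lemma polytime_mkseq G A (m : forall F, env F G -> den F TNat)
    (f : forall F, env F (TNat :: G) -> den F A) :
    polytime m -> polytime f ->
  polytime (A := TList A) (fun F e => mkseq (fun k => f F (k, e)) (m F e)).
Proof.
move=> hm hf.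
pose body F (e : env F (TNat :: G)) : den F (TList A) :=
  mkseq (fun k => f F (k, e.2)) e.1.
suff hbody : polytime body by exact: (polytime_let hm hbody).
(* Lists grow at the front only, so round [j] computes the entry of index [m0 - j.+1]. *)
have itE (F : fieldType) (m0 : nat) (e : env F G) j : (j <= m0)%N ->
    iteri j (fun j (x : den F (TList A)) => f F ((m0 - j.+1)%N, e) :: x) [::] =
    mkseq (fun t => f F ((m0 - j + t)%N, e)) j.
  elim: j => // j IHj jm; rewrite /= IHj ?(ltnW jm) // /mkseq /= addn0; congr (_ :: _).
  rewrite (iotaDl 1 0) -map_comp; apply: eq_map => t /=.
  by congr (f F (_, _)); lia.
have [c hc] := polytime_size hf.
apply: polytime_ext (@polytime_natrec (TNat :: G) (TList A) (fun F e => e.1)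
  (fun F e => [::])
  (fun F e => f F ((e.2.2.1 - e.1.+1)%N, e.2.2.2) :: e.2.1)
  (fun F e => e.1 * ((esize e).+2 ^ c).+1)%N _ _ _ _ _) => [F e|||||F e k kb].
- rewrite [in X in iteri _ X]/= itE // subnn; apply: eq_map => t.
  by rewrite add0n.
- by ptvar.
- exact: polytime_nil.
- apply: polytime_cons; last by ptvar.
  pose H := TNat :: TList A :: TNat :: G.
  have h1 : polytime (A := TNat) (fun F (e : env F H) => e.2.2.1 - e.1.+1)%N.
    by apply: polytime_sub; [|apply: polytime_succ]; ptvar.
  exact: (polytime_let h1 (polytime_wk1 TNat (polytime_wk1 (TList A) (polytime_wk1 TNat hf)))).
- apply: poly_boundedM; first exact: (polytime_size (@polytime_var0 _ TNat)).
  apply/poly_boundedS/poly_boundedX/poly_boundedS/poly_boundedS.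
  exact: poly_bounded_esize.
- rewrite [in X in iteri _ X]/= itE //.
  apply: leq_trans (_ : k * ((esize e).+2 ^ c).+1 <= _)%N; last by rewrite leq_mul2r kb orbT.
  apply: leq_tsize_mkseq => t tk; apply: leq_trans (hc _ _) _.
  case: (c) => // c'; rewrite leq_exp2r // !ltnS [esize _]/=.
  rewrite [X in (_ <= X)%N]/= leq_add2r; move: kb tk => /=.
  by move: (e.1) => m0; lia.
Qed.

Lemma polytime_behead G A (l : forall F, env F G -> den F (TList A)) :
  polytime l -> polytime (A := TList A) (fun F e => behead (l F e)).
Proof.
move=> hl; apply: polytime_ext (@polytime_listcase G A (TList A) l (fun F e => [::])
  (fun F e => e.2.1) hl _ _) => [F e||].
- by case: (l F e).
- exact: polytime_nil.
- by ptvar.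
Qed.

Lemma tsize_drop F A k (l : den F (TList A)) :
  (tsize (A := TList A) (drop k l) <= tsize (A := TList A) l)%N.
Proof. by rewrite -{2}(cat_take_drop k l) tsize_cat leq_addl. Qed.

Lemma polytime_nth G A (x0 : forall F, den F A)
    (l : forall F, env F G -> den F (TList A))
    (k : forall F, env F G -> den F TNat) :
    (forall G, polytime (fun F (_ : env F G) => x0 F)) ->
    polytime l -> polytime k ->
  polytime (fun F e => nth (x0 F) (l F e) (k F e)).
Proof.
move=> hx hl hk.
have itE (F : fieldType) j (s : den F (TList A)) :
    iteri j (fun _ (y : den F (TList A)) => behead y) s = drop j s.
  by elim: j => [|j /= ->]; rewrite ?drop0 // -drop1 drop_drop add1n.
have hd : polytime (A := TList A) (fun F e => drop (k F e) (l F e)).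
  apply: polytime_ext (@polytime_natrec G (TList A) k l (fun F e => behead e.2.1)
    (fun F e => tsize (A := TList A) (l F e)) hk hl _ _ _) => [F e|||F e j jk].
  - exact: itE.
  - by apply: polytime_behead; ptvar.
  - exact: polytime_size hl.
  - by rewrite [in X in iteri _ X]/= itE tsize_drop.
apply: polytime_ext (@polytime_listcase G A A _ (fun F e => x0 F)
  (fun F e => e.1) hd (hx _) _) => [F e|]; last by ptvar.
rewrite -[in RHS](addn0 (k F e)) -nth_drop nth0; by case: (drop _ _).
Qed.

(** * The algorithm *)

(** The length is a safe upper bound; the trailing zeros do no harm, because lists are compared by
    [peq] and decoded by [Poly]. *)
Definition pmul (F : fieldType) (p q : seq F) : seq F :=
  mkseq (fun k => \sum_(j < k.+1) p`_j * q`_(k - j)) (size p + size q).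

Definition peq (F : fieldType) (p q : seq F) : nat :=
  iteri (size p + size q) (fun k b => if p`_k == q`_k then b else 0%N) 1%N.

Definition ppow (F : fieldType) (p : seq F) (i : nat) : seq F :=
  iteri i (fun _ q => pmul p q) [:: 1].

Definition paddc (F : fieldType) (c : F) (p : seq F) : seq F :=
  (p`_0 + c) :: behead p.

(* [c] stands for the monic polynomial with lower coefficients [c]; the result
   is [0] if it is the product of [h] and a member of [L], and [b] otherwise. *)
Definition avoids_factor (F : fieldType) (c : seq F) (L : seq (seq F))
    (h : seq F) (b : nat) : nat :=
  foldr (fun h' b => if peq (pmul h h') (rcons c 1) is _.+1 then 0%N else b) b L.

Definition no_factors (F : fieldType) (L : seq (seq F)) (c : seq F) : nat :=
  foldr (fun h b => avoids_factor c L h b) 1%N L.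

Definition find_irreducible (F : fieldType) (L : seq (seq F)) : seq F :=
  foldr (fun c g => if no_factors L c is _.+1 then rcons c 1 else g) [::] L.

Definition prepend_all (F : fieldType) (c : F) (L acc : seq (seq F)) :
    seq (seq F) :=
  foldr (fun l acc => (c :: l) :: acc) acc L.

(** Extension happens only below [N] members, so no round yields more than [size elts * N] lists;
    this keeps the enumeration, and the search through pairs of its members, polynomial. *)
Definition extend_lists (F : fieldType) (elts : seq F) (N : nat)
    (L : seq (seq F)) : seq (seq F) :=
  if (N <= size L)%N then L
  else foldr (fun c acc => prepend_all c L acc) [::] elts.

Definition enum_lists (F : fieldType) (elts : seq F) (N : nat) : seq (seq F) :=
  iteri N (fun _ L => extend_lists elts N L) [:: [::]].

Definition curve_point (F : fieldType) (n i : nat) (z : seq F) : seq (seq F) :=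
  z :: mkseq (fun j => ppow (paddc j.+1%:R z) i) n.-1.

Definition hitting_set (F : fieldType) (n i N : nat) (elts : seq F) :
    seq F * seq (seq (seq F)) :=
  let L := enum_lists elts N in
  (find_irreducible L, mkseq (fun k => curve_point n i (nth [::] L k)) N).

(** * The algorithm runs in polynomial time *)

Local Notation TPoly := (TList TFld).

Lemma tsize_poly F (l : den F TPoly) : tsize (A := TPoly) l = size l.
Proof. by elim: l => //= x l ->. Qed.

Lemma polytime_lsize G A (l : forall F, env F G -> den F (TList A)) :
  polytime l -> polytime (A := TNat) (fun F e => size (l F e)).
Proof.
move=> hl.
have foldE F (s : den F (TList A)) :
    foldr (fun (_ : den F A) (y : nat) => y.+1) 0%N s = size s by elim: s => //= x s ->.
have szle F (s : den F (TList A)) : (size s <= tsize (A := TList A) s)%N.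
  by elim: s => //= x s; lia.
apply: polytime_ext (@polytime_listrec G A TNat l (fun F e => 0%N)
  (fun F e => e.2.1.+1) (fun F e => tsize (A := TList A) (l F e)) hl _ _ _ _)
  => [F e||||F e l1 l2 ll].
- exact: foldE.
- exact: polytime_zero.
- by apply: polytime_succ; ptvar.
- exact: polytime_size hl.
- rewrite [in X in foldr X]/= foldE ll tsize_cat.
  exact: leq_trans (szle _ _) (leq_addl _ _).
Qed.

Lemma polytime_coef G (l : forall F, env F G -> den F TPoly)
    (k : forall F, env F G -> den F TNat) :
  polytime l -> polytime k ->
  polytime (A := TFld) (fun F e => (l F e)`_(k F e) : F).
Proof.
by apply: (@polytime_nth G TFld (fun F => 0)) => G'; apply: polytime_f0.
Qed.

Lemma polytime_sum G (m : forall F, env F G -> den F TNat)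
    (f : forall F, env F (TNat :: G) -> den F TFld) :
    polytime m -> polytime f ->
  polytime (A := TFld) (fun F e => \sum_(j < m F e) (f F (nat_of_ord j, e) : F)).
Proof.
move=> hm hf.
apply: polytime_ext (@polytime_natrec G TFld m (fun F e => 0)
  (fun F e => e.2.1 + f F (e.1, e.2.2)) (fun F e => 0%N) hm _ _ _ _)
  => [F e||||F e k km] //.
- move: (m F e) => k; elim: k => [|k IHk]; first by rewrite big_ord0.
  by rewrite big_ord_recr /= IHk.
- exact: polytime_f0.
- apply: polytime_fadd; first by ptvar.
  exact: (polytime_wk1 TFld hf).
- exact: poly_bounded_const.
Qed.

Lemma polytime_pmul G (p q : forall F, env F G -> den F TPoly) :
  polytime p -> polytime q ->
  polytime (A := TPoly) (fun F e => pmul (p F e) (q F e)).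
Proof.
apply: (@polytime_app2 G TPoly TPoly TPoly pmul).
apply: (@polytime_mkseq (TPoly :: TPoly :: G) TFld
  (fun F e => size e.1 + size e.2.1)%N
  (fun F e => \sum_(j < e.1.+1) e.2.1`_j * e.2.2.1`_(e.1 - j))).
  by apply: polytime_add; apply: (@polytime_lsize _ TFld); ptvar.
apply: (@polytime_sum (TNat :: TPoly :: TPoly :: G) (fun F e => e.1.+1)
  (fun F e => e.2.2.1`_e.1 * e.2.2.2.1`_(e.2.1 - e.1))).
  by apply: polytime_succ; ptvar.
apply: polytime_fmul; apply: polytime_coef; try ptvar.
by apply: polytime_sub; ptvar.
Qed.

Lemma polytime_peq G (p q : forall F, env F G -> den F TPoly) :
  polytime p -> polytime q ->
  polytime (A := TNat) (fun F e => peq (p F e) (q F e)).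
Proof.
apply: (@polytime_app2 G TPoly TPoly TNat peq).
apply: (@polytime_natrec (TPoly :: TPoly :: G) TNat
  (fun F e => size e.1 + size e.2.1)%N (fun F e => 1%N)
  (fun F e => if e.2.2.1`_e.1 == e.2.2.2.1`_e.1 then e.2.1 else 0%N)
  (fun F e => 1%N)) => [||||F e k km].
- by apply: polytime_add; apply: (@polytime_lsize _ TFld); ptvar.
- exact/polytime_succ/polytime_zero.
- apply: polytime_fifeq; try (by apply: polytime_coef; ptvar); first by ptvar.
  exact: polytime_zero.
- exact: poly_bounded_const.
- by rewrite [in X in iteri _ X]/=; elim: k {km} => //= k IHk; case: ifP.
Qed.

Lemma size_ppow_le (F : fieldType) (p : seq F) i :
  (size (ppow p i) <= 1 + size p * i)%N.
Proof.
rewrite /ppow; elim: i => [|i IHi]; first by rewrite muln0.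
by rewrite /= {1}/pmul size_mkseq mulnS addnCA leq_add2l.
Qed.

Lemma polytime_ppow G (p : forall F, env F G -> den F TPoly)
    (i : forall F, env F G -> den F TNat) :
  polytime p -> polytime i ->
  polytime (A := TPoly) (fun F e => ppow (p F e) (i F e)).
Proof.
apply: (@polytime_app2 G TPoly TNat TPoly ppow).
apply: (@polytime_natrec (TPoly :: TNat :: G) TPoly (fun F e => e.2.1)
  (fun F e => [:: 1]) (fun F e => pmul e.2.2.1 e.2.1)
  (fun F e => 1 + tsize (A := TPoly) e.1 * e.2.1)%N) => [||||F e k km].
- by ptvar.
- by apply: polytime_cons; [exact: polytime_f1|exact: polytime_nil].
- by apply: polytime_pmul; ptvar.
- apply/poly_boundedD/poly_boundedM; first exact: poly_bounded_const.
    exact: (polytime_size (@polytime_var0 _ TPoly)).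
  exact: (polytime_size (@polytime_var1 _ TNat TPoly)).
- rewrite [in X in iteri _ X]/= !tsize_poly.
  by apply: leq_trans (size_ppow_le _ _) _; rewrite leq_add2l leq_mul2l km orbT.
Qed.

Lemma polytime_paddc G (c : forall F, env F G -> den F TFld)
    (p : forall F, env F G -> den F TPoly) :
  polytime c -> polytime p ->
  polytime (A := TPoly) (fun F e => paddc (c F e : F) (p F e)).
Proof.
move=> hc hp; apply: polytime_cons; last exact: polytime_behead.
apply: polytime_fadd hc; apply: polytime_coef hp _; exact: polytime_zero.
Qed.

Lemma polytime_rcons1 G (p : forall F, env F G -> den F TPoly) :
  polytime p -> polytime (A := TPoly) (fun F e => rcons (p F e) (1 : F)).
Proof.
move=> hp.
have foldE F (s t : den F TPoly) : foldr (fun (x : F) y => x :: y) t s = s ++ t.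
  by elim: s => //= x s ->.
apply: polytime_ext (@polytime_listrec G TFld TPoly p (fun F e => [:: 1])
  (fun F e => e.1 :: e.2.1) (fun F e => (tsize (A := TPoly) (p F e)).+1) hp _ _ _ _)
  => [F e||||F e l1 l2 ll].
- by rewrite [in X in foldr X]/= foldE cats1.
- by apply: polytime_cons; [exact: polytime_f1|exact: polytime_nil].
- by apply: polytime_cons; ptvar.
- exact/poly_boundedS/(polytime_size hp).
- by rewrite [in X in foldr X]/= foldE !tsize_poly ll !size_cat /=; lia.
Qed.

Lemma avoids_factor_le (F : fieldType) (c : seq F) L h b :
  (avoids_factor c L h b <= b)%N.
Proof. by rewrite /avoids_factor; elim: L => //= h' L IHL; case: (peq _ _). Qed.

Lemma polytime_avoids_factor G (c : forall F, env F G -> den F TPoly)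
    (L : forall F, env F G -> den F (TList TPoly))
    (h : forall F, env F G -> den F TPoly) (b : forall F, env F G -> den F TNat) :
  polytime c -> polytime L -> polytime h -> polytime b ->
  polytime (A := TNat) (fun F e => avoids_factor (c F e) (L F e) (h F e) (b F e)).
Proof.
move=> hc hL hh hb.
have hw : polytime (A := TNat) (fun F (e : env F (TPoly :: TNat :: G)) =>
    if peq (pmul (h F e.2.2) e.1) (rcons (c F e.2.2) (1 : F)) is _.+1 then 0%N else e.2.1).
  have h2 : polytime (fun F (e : env F (TPoly :: TNat :: G)) => h F e.2.2).
    exact: (polytime_wk TPoly (polytime_wk TNat hh)).
  have c2 : polytime (fun F (e : env F (TPoly :: TNat :: G)) => c F e.2.2).
    exact: (polytime_wk TPoly (polytime_wk TNat hc)).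
  apply: (@polytime_natcase (TPoly :: TNat :: G) TNat (fun F e =>
    peq (pmul (h F e.2.2) e.1) (rcons (c F e.2.2) (1 : F))) (fun F e => e.2.1)
    (fun F e => 0%N)); [|ptvar|exact: polytime_zero].
  apply: polytime_peq; last exact: polytime_rcons1.
  by apply: polytime_pmul => //; ptvar.
apply: (@polytime_listrec G TPoly TNat L b _ (fun F e => b F e) hL hb hw).
  exact: polytime_size hb.
by move=> F e l1 l2 _; exact: (avoids_factor_le (c F e) l2 (h F e) (b F e)).
Qed.

Lemma no_factors_le (F : fieldType) (c : seq F) (L L' : seq (seq F)) :
  (foldr (fun h b => avoids_factor c L h b) 1%N L' <= 1)%N.
Proof.
elim: L' => //= h L' IH; exact: leq_trans (avoids_factor_le _ _ _ _) IH.
Qed.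

Lemma polytime_no_factors G (L : forall F, env F G -> den F (TList TPoly))
    (c : forall F, env F G -> den F TPoly) :
  polytime L -> polytime c ->
  polytime (A := TNat) (fun F e => no_factors (L F e) (c F e)).
Proof.
move=> hL hc.
have L2 : polytime (fun F (e : env F (TPoly :: TNat :: G)) => L F e.2.2).
  exact: (polytime_wk TPoly (polytime_wk TNat hL)).
have c2 : polytime (fun F (e : env F (TPoly :: TNat :: G)) => c F e.2.2).
  exact: (polytime_wk TPoly (polytime_wk TNat hc)).
apply: (@polytime_listrec G TPoly TNat L (fun F e => 1%N)
  (fun F e => avoids_factor (c F e.2.2) (L F e.2.2) e.1 e.2.1) (fun F e => 1%N) hL).
- exact/polytime_succ/polytime_zero.
- by apply: polytime_avoids_factor => //; ptvar.
- exact: poly_bounded_const.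
- by move=> F e l1 l2 _; exact: (no_factors_le (c F e) (L F e) l2).
Qed.

Lemma size_find_irreducible_le (F : fieldType) (L L' : den F (TList TPoly)) :
  (size (foldr (fun c g => if no_factors L c is _.+1 then rcons c (1%R : F) else g)
    [::] L') <= tsize (A := TList TPoly) L')%N.
Proof.
elim: L' => //= c L' IH; rewrite -/(tsize (A := TPoly) c) tsize_poly.
case: (no_factors _ _) => [|k]; first by apply: leq_trans IH (leq_addl _ _).
by rewrite size_rcons leq_addr.
Qed.

Lemma polytime_find_irreducible G (L : forall F, env F G -> den F (TList TPoly)) :
  polytime L ->
  polytime (A := TPoly) (fun F e => find_irreducible (L F e)).
Proof.
move=> hL.
have L2 : polytime (fun F (e : env F (TPoly :: TPoly :: G)) => L F e.2.2).
  exact: (polytime_wk TPoly (polytime_wk TPoly hL)).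
apply: (@polytime_listrec G TPoly TPoly L (fun F e => [::])
  (fun F e => if no_factors (L F e.2.2) e.1 is _.+1 then rcons e.1 (1 : F) else e.2.1)
  (fun F e => tsize (A := TList TPoly) (L F e)) hL).
- exact: polytime_nil.
- apply: (@polytime_natcase (TPoly :: TPoly :: G) TPoly (fun F e => no_factors (L F e.2.2) e.1)
    (fun F e => e.2.1) (fun F e => rcons e.2.1 (1 : F))); [|by ptvar|].
  + by apply: polytime_no_factors => //; ptvar.
  + by apply: polytime_rcons1; ptvar.
- exact: polytime_size hL.
- move=> F e l1 l2 ->; rewrite tsize_cat.
  apply: leq_trans (leq_addl _ _); rewrite tsize_poly.
  exact: (size_find_irreducible_le (l1 ++ l2) l2).
Qed.

Lemma prepend_allE (F : fieldType) (c : F) L acc :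
  prepend_all c L acc = [seq c :: l | l <- L] ++ acc.
Proof. by rewrite /prepend_all; elim: L => //= l L ->. Qed.

Lemma extend_listsE (F : fieldType) (elts : seq F) N L :
  extend_lists elts N L =
  if (N <= size L)%N then L else [seq c :: l | c <- elts, l <- L].
Proof.
rewrite /extend_lists; case: ifP => // _.
by elim: elts => //= c elts ->; rewrite prepend_allE.
Qed.

Lemma tsize_lists F (L : den F (TList TPoly)) :
  tsize (A := TList TPoly) L = (\sum_(l <- L) (size l).+1)%N.
Proof.
elim: L => [|l L IHL]; first by rewrite big_nil.
by rewrite big_cons -IHL /= -/(tsize (A := TPoly) l) tsize_poly.
Qed.

Lemma tsize_map_cons (F : fieldType) (c : F) (L : den F (TList TPoly)) :
  tsize (A := TList TPoly) [seq c :: l | l <- L] =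
  (tsize (A := TList TPoly) L + size L)%N.
Proof.
rewrite !tsize_lists big_map -sum1_size -big_split.
by apply: eq_bigr => l _; rewrite /= addn1.
Qed.

Lemma size_le_tsize F A (s : den F (TList A)) :
  (size s <= tsize (A := TList A) s)%N.
Proof. by elim: s => //= x s; lia. Qed.

Lemma polytime_prepend_all G (c : forall F, env F G -> den F TFld)
    (L acc : forall F, env F G -> den F (TList TPoly)) :
  polytime c -> polytime L -> polytime acc ->
  polytime (A := TList TPoly) (fun F e => prepend_all (c F e : F) (L F e) (acc F e)).
Proof.
move=> hc hL ha.
have c2 : polytime (fun F (e : env F (TPoly :: TList TPoly :: G)) => c F e.2.2).
  exact: (polytime_wk TPoly (polytime_wk (TList TPoly) hc)).
apply: (@polytime_listrec G TPoly (TList TPoly) L acc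
  (fun F e => (c F e.2.2 :: e.1) :: e.2.1)
  (fun F e => tsize (A := TList TPoly) (L F e) + tsize (A := TList TPoly) (L F e) +
     tsize (A := TList TPoly) (acc F e))%N hL ha).
- apply: polytime_cons; last by ptvar.
  by apply: polytime_cons => //; ptvar.
- by do !apply: poly_boundedD; exact: polytime_size.
move=> F e l1 l2 ll.
have -> : foldr (fun (x : den F TPoly) (y : den F (TList TPoly)) =>
    (c F e :: x) :: y) (acc F e) l2 = prepend_all (c F e : F) l2 (acc F e) by [].
rewrite prepend_allE tsize_cat tsize_map_cons leq_add2r ll tsize_cat.
have := @size_le_tsize F TPoly l2.
by move: (tsize _) (tsize _) (size l2); lia.
Qed.

Lemma polytime_extend_lists G (elts : forall F, env F G -> den F TPoly)
    (N : forall F, env F G -> den F TNat)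
    (L : forall F, env F G -> den F (TList TPoly)) :
  polytime elts -> polytime N -> polytime L ->
  polytime (A := TList TPoly) (fun F e => extend_lists (elts F e) (N F e) (L F e)).
Proof.
move=> he hN hL; apply: polytime_ifleq => //; first exact: (@polytime_lsize _ TPoly).
have L2 : polytime (fun F (e : env F (TFld :: TList TPoly :: G)) => L F e.2.2).
  exact: (polytime_wk TFld (polytime_wk (TList TPoly) hL)).
apply: (@polytime_listrec G TFld (TList TPoly) elts (fun F e => [::])
  (fun F e => prepend_all (e.1 : F) (L F e.2.2) e.2.1)
  (fun F e => tsize (A := TPoly) (elts F e) *
     (tsize (A := TList TPoly) (L F e) + tsize (A := TList TPoly) (L F e)))%N he).
- exact: polytime_nil.
- by apply: polytime_prepend_all => //; ptvar.
- by apply: poly_boundedM; [|apply: poly_boundedD]; exact: polytime_size.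
move=> F e l1 l2 ->; rewrite tsize_cat mulnDl; apply: leq_trans (leq_addl _ _).
elim: l2 => // c l2 IH.
rewrite [foldr _ _ _]/= prepend_allE tsize_cat tsize_map_cons.
rewrite [X in (_ <= X * _)%N]/= add1n mulSn; apply: leq_add => //.
by rewrite leq_add2l (@size_le_tsize F TPoly).
Qed.

Definition lists_bounded (F : fieldType) (L : seq (seq F)) B m :=
  (size L <= B)%N /\ forall l, l \in L -> (size l <= m)%N.

Lemma enum_lists_bounded (F : fieldType) (elts : seq F) N k :
  lists_bounded (iteri k (fun _ L => extend_lists elts N L) [:: [::]])
    (1 + size elts * N) k.
Proof.
elim: k => [|k [sz el]]; first by split=> //= l; rewrite inE => /eqP->.
rewrite /= extend_listsE; case: leqP => NL; first by split=> // l /el /leqW.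
split; first by rewrite size_allpairs; nia.
by move=> l /allpairsP [[c l'] /= [_ /el ? ->]].
Qed.

Lemma tsize_lists_bounded F (L : den F (TList TPoly)) B m :
  lists_bounded L B m -> (tsize (A := TList TPoly) L <= B * m.+1)%N.
Proof.
move=> [sz el]; rewrite tsize_lists; apply: (@leq_trans (size L * m.+1)).
  rewrite -sum1_size big_distrl /= big_seq [X in (_ <= X)%N]big_seq.
  by apply: leq_sum => l /el; rewrite mul1n ltnS.
by rewrite leq_mul2r sz orbT.
Qed.

Lemma polytime_enum_lists G (elts : forall F, env F G -> den F TPoly)
    (N : forall F, env F G -> den F TNat) :
  polytime elts -> polytime N ->
  polytime (A := TList TPoly) (fun F e => enum_lists (elts F e) (N F e)).
Proof.
move=> he hN.
have e2 : polytime (fun F (e : env F (TNat :: TList TPoly :: G)) => elts F e.2.2).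
  exact: (polytime_wk TNat (polytime_wk (TList TPoly) he)).
have N2 : polytime (fun F (e : env F (TNat :: TList TPoly :: G)) => N F e.2.2).
  exact: (polytime_wk TNat (polytime_wk (TList TPoly) hN)).
apply: (@polytime_natrec G (TList TPoly) N (fun F e => [:: [::]])
  (fun F e => extend_lists (elts F e.2.2) (N F e.2.2) e.2.1)
  (fun F e => (1 + tsize (A := TPoly) (elts F e) * N F e) * (N F e).+1)%N hN).
- by apply: polytime_cons; apply: polytime_nil.
- by apply: polytime_extend_lists => //; ptvar.
- apply/poly_boundedM/poly_boundedS; last exact: (polytime_size hN).
  apply/poly_boundedD/poly_boundedM; first exact: poly_bounded_const.
    exact: polytime_size he.
  exact: (polytime_size hN).
move=> F e k kN; rewrite tsize_poly.
have /tsize_lists_bounded := enum_lists_bounded (elts F e) (N F e) k.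
by move/leq_trans; apply; rewrite leq_mul2l ltnS kN orbT.
Qed.

Lemma polytime_curve_point G (n i : forall F, env F G -> den F TNat)
    (z : forall F, env F G -> den F TPoly) :
  polytime n -> polytime i -> polytime z ->
  polytime (A := TList TPoly) (fun F e => curve_point (n F e) (i F e) (z F e)).
Proof.
move=> hn hi hz; apply: polytime_cons => //.
apply: (@polytime_mkseq G TPoly (fun F e => (n F e).-1)
  (fun F e => ppow (paddc (e.1.+1%:R : F) (z F e.2)) (i F e.2))).
  exact: polytime_pred.
apply: polytime_ppow; last exact: (polytime_wk TNat hi).
apply: polytime_paddc; last exact: (polytime_wk TNat hz).
by apply: polytime_natr; apply: polytime_succ; ptvar.
Qed.

Lemma polytime_hitting_set G (n i N : forall F, env F G -> den F TNat)
    (elts : forall F, env F G -> den F TPoly) :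
  polytime n -> polytime i -> polytime N -> polytime elts ->
  polytime (A := TProd TPoly (TList (TList TPoly)))
    (fun F e => hitting_set (n F e) (i F e) (N F e) (elts F e)).
Proof.
move=> hn hi hN he.
pose body F (e : env F (TList TPoly :: G)) :
    den F (TProd TPoly (TList (TList TPoly))) :=
  (find_irreducible e.1,
   mkseq (fun k => curve_point (n F e.2) (i F e.2) (nth [::] e.1 k)) (N F e.2)).
suff hbody : polytime body by exact: (polytime_let (polytime_enum_lists he hN) hbody).
apply: polytime_pair; first by apply: polytime_find_irreducible; ptvar.
apply: (@polytime_mkseq (TList TPoly :: G) (TList TPoly) (fun F e => N F e.2)
  (fun F e => curve_point (n F e.2.2) (i F e.2.2) (nth [::] e.2.1 e.1))).
  exact: (polytime_wk (TList TPoly) hN).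
apply: polytime_curve_point.
- exact: (polytime_wk TNat (polytime_wk (TList TPoly) hn)).
- exact: (polytime_wk TNat (polytime_wk (TList TPoly) hi)).
apply: (@polytime_nth _ TPoly (fun F => [::])); try ptvar.
by move=> G'; apply: polytime_nil.
Qed.

(** * Irreducible polynomials over finite fields *)

Lemma natr_card_finField (F : finFieldType) : #|F|%:R = 0 :> F.
Proof.
have [p p_pr pF] := finPcharP F.
have := card_pprimeChar pF; set e := logn _ _ => De.
have De' : #|F| = (p ^ e)%N by [].
have := finNzRing_gt1 F; rewrite De'; case: e {De De'} => // e _.
by rewrite natrX (pcharf0 pF) expr0n.
Qed.

(** In a splitting field of X^m - X with m = |F|^k, the roots are distinct and are exactly the fixed
    points of the k-th power of the Frobenius generator. They form a subfield, which contains the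
    generators of the splitting field and so is all of it: the extension has m elements and
    dimension k. *)
Lemma finField_ext_exists (F : finFieldType) k :
  (0 < k)%N -> exists L : splittingFieldType F, \dim {:L} = k.
Proof.
move=> k_gt0; set m := (#|F| ^ k)%N.
have F_gt1 := finNzRing_gt1 F.
have m_gt1 : (1 < m)%N by rewrite (ltn_exp2l 0).
pose q (R : nzRingType) : {poly R} := 'X^m - 'X.
have szq (R : nzRingType) : size (q R) = m.+1.
  by rewrite size_polyDl size_polyXn // size_polyN size_polyX.
have q0 : q F != 0 by rewrite -size_poly_gt0 szq.
have [L [zs Dq defL]] := FinSplittingFieldFor q0.
exists L; move: Dq; rewrite rmorphB rmorphXn /= map_polyX -/(q L) => Dq.
have Uzs : uniq zs.
  rewrite -separable_prod_XsubC -(eqp_separable Dq) /q.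
  have -> : separable_poly ('X^m - 'X : {poly L}) = coprimep ('X^m - 'X : {poly L}) (-1).
    rewrite separable_poly.unlock derivB derivX derivXn -mulr_natl.
    have -> : (m%:R : {poly L}) = 0.
      rewrite /m natrX -polyC_natr -(rmorph_nat (in_alg L)) natr_card_finField.
      by rewrite rmorph0 polyC0 expr0n gtn_eqF.
    by rewrite mul0r sub0r.
  by rewrite -[X in coprimep _ X]scaleN1r coprimepZr ?coprimep1 // oppr_eq0 oner_eq0.
have szs : size zs = m.
  by apply: succn_inj; rewrite -(size_prod_XsubC _ id) -(eqp_size Dq) szq.
have [/= a _ Da] := finField_galois_generator (sub1v {:L}).
rewrite dimv1 expn1 in Da.
pose E := fixedSpace (a ^+ k)%g.
have in_zs : zs =i E.
  move=> z; rewrite -root_prod_XsubC -(eqp_root Dq) (sameP fixedSpaceP eqP).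
  rewrite /root !hornerE subr_eq0 /m; congr (_ == z).
  elim: (k) => [|i IHi]; first by rewrite gal_id.
  by rewrite expgSr expnSr exprM IHi galM ?Da ?memvf.
have EL : E = {:L}%VS.
  apply/eqP; rewrite eqEsubv subvf -defL -[E]subfield_closed agenvS //.
  by rewrite subv_add sub1v; apply/span_subvP => z; rewrite in_zs.
have : #|finvect_type L| = m.
  pose zs' : seq (finvect_type L) := zs.
  have Uzs' : uniq zs' by [].
  rewrite -szs -[size zs]/(size zs') -(card_uniqP Uzs'); apply: eq_card => z.
  by apply/esym; rewrite [z \in _]in_zs EL memvf.
rewrite -(card_vspacef (Vector.class (finvect_type L))) card_vspace => /eqP.
by rewrite eqn_exp2l // => /eqP.
Qed.

(** The polynomial is the minimal polynomial of a primitive element of an extension of degree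
    [k]. *)
Lemma irreducible_poly_exists (F : finFieldType) k : (0 < k)%N ->
  exists2 g : {poly F}, g \is monic & size g = k.+1 /\ irreducible_poly g.
Proof.
move=> k_gt0; have [L dimL] := finField_ext_exists F k_gt0.
have /and3P[_ sepL _] := finField_galois (sub1v {:L}).
have := eq_adjoin_separable_generator sepL (sub1v _).
set t := separable_generator _ _ => Lt.
have [g Dg] := polyOver1P (minPolyOver 1 t).
have sz : size (minPoly 1 t) = k.+1.
  by rewrite size_minPoly; have := dim_Fadjoin 1 t; rewrite -Lt dimL dimv1 muln1 => <-.
have szg : size g = k.+1 by rewrite -sz Dg size_map_poly.
exists g; first by rewrite -(map_monic (in_alg L)) -Dg monic_minPoly.
split=> //; split; first by rewrite szg.
move=> h szh hg.
have := @minPoly_irr _ _ 1%AS t (map_poly (in_alg L) h) _ _.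
rewrite Dg dvdp_map eqp_map hg -size_poly_eq1 size_map_poly (negPf szh) orbF.
by apply=> //; apply/polyOver1P; exists h.
Qed.

(** A complete duplicate-free list gives the abstract field a finite field structure, to which the
    preceding result applies. *)
Lemma irreducible_poly_exists_enum (F : fieldType) (elts : seq F) k :
    uniq elts -> (forall x, x \in elts) -> (0 < k)%N ->
  exists2 g : {poly F}, g \is monic & size g = k.+1 /\ irreducible_poly g.
Proof.
move=> uelts elts_all.
have pK : pcancel (fun x => index x elts) (fun j => Some (nth 0 elts j)).
  by move=> x; rewrite nth_index.
have fP : Finite.axiom elts by move=> x; rewrite count_uniq_mem // elts_all.
pose FF : finFieldType := HB.pack F (isCountable.Build F pK) (isFinite.Build F fP).
exact: (@irreducible_poly_exists FF k).
Qed.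

(** * Correctness of the program *)

Section ListPolynomials.

Variable F : fieldType.
Implicit Types (p q : seq F).

Lemma Poly_pmul p q : Poly (pmul p q) = Poly p * Poly q.
Proof.
apply/polyP => k; rewrite coef_Poly coefM.
have [lt|ge] := ltnP k (size p + size q).
  by rewrite nth_mkseq //; apply: eq_bigr => j _; rewrite !coef_Poly.
rewrite nth_default ?size_mkseq // big1 // => j _; rewrite !coef_Poly.
have [pj|pj] := leqP (size p) j; first by rewrite nth_default ?mul0r.
rewrite [q`_ _]nth_default ?mulr0 //.
by move: ge pj; move: (size p) (size q) => a b; lia.
Qed.

Lemma Poly_ppow p i : Poly (ppow p i) = Poly p ^+ i.
Proof.
rewrite /ppow; elim: i => [|i IHi] /=; last by rewrite Poly_pmul IHi exprS.
by rewrite cons_poly_def mul0r add0r.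
Qed.

Lemma Poly_paddc c p : Poly (paddc c p) = Poly p + c%:P.
Proof.
case: p => [|x p]; rewrite /paddc /= !cons_poly_def polyCD ?mul0r ?add0r //.
by rewrite addrA.
Qed.

Lemma peqE p q : (peq p q == 0)%N = (Poly p != Poly q).
Proof.
have key m : (iteri m (fun k b => if p`_k == q`_k then b else 0%N) 1%N == 0%N) =
    ~~ [forall k : 'I_m, p`_k == q`_k].
  elim: m => [|m IHm] /=.
    by apply/esym/negbTE/negPn/forallP => -[].
  have [e|ne] := eqVneq p`_m q`_m; last first.
    suff -> : [forall k : 'I_m.+1, p`_k == q`_k] = false by [].
    by apply/forallP => /(_ ord_max); apply/negP.
  rewrite IHm; congr (~~ _); apply/forallP/forallP => h k.
    have [km|km] := ltnP k m; first exact: (h (Ordinal km)).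
    have km' : nat_of_ord k = m by have := ltn_ord k; lia.
    by rewrite km' e.
  exact: (h (widen_ord (leqnSn m) k)).
rewrite /peq key; congr (~~ _); apply/forallP/eqP => [h|e k].
  apply/polyP => k; rewrite !coef_Poly.
  have [lt|ge] := ltnP k (size p + size q); first exact/eqP/(h (Ordinal lt)).
  by rewrite !nth_default //; move: ge; move: (size p) (size q) => a b; lia.
by have := congr1 (fun r : {poly F} => r`_k) e; rewrite /= !coef_Poly => ->.
Qed.

Lemma no_factorsP L (c : seq F) :
  reflect (exists h h', [/\ h \in L, h' \in L & Poly h * Poly h' = Poly (rcons c 1)])
    (no_factors L c == 0)%N.
Proof.
have avoidE L' h b : (avoids_factor c L' h b == 0)%N =
    has (fun h' => Poly h * Poly h' == Poly (rcons c 1)) L' || (b == 0)%N.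
  rewrite /avoids_factor; elim: L' => //= h' L' IH.
  have := peqE (pmul h h') (rcons c 1); rewrite Poly_pmul.
  case: (peq _ _) => [|k] /=; rewrite ?eqxx => e; last first.
    by move/esym/negPn: e => ->.
  by rewrite -[_ == Poly _]negbK -e /= IH.
have -> : (no_factors L c == 0)%N =
    has (fun h => has (fun h' => Poly h * Poly h' == Poly (rcons c 1)) L) L.
  rewrite /no_factors; move: {2 4}L => L'; elim: L' => //= h L' IH.
  by rewrite avoidE IH.
apply: (iffP hasP) => [[h hL /hasP[h' h'L /eqP e]]|[h [h' [hL h'L e]]]].
  by exists h, h'.
by exists h => //; apply/hasP; exists h' => //; apply/eqP.
Qed.

Lemma find_irreducibleP L (c0 : seq F) :
    c0 \in L -> no_factors L c0 != 0%N ->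
  exists2 c, c \in L & no_factors L c != 0%N /\ find_irreducible L = rcons c 1.
Proof.
move=> c0L nf0; rewrite /find_irreducible.
suff key L' : c0 \in L' -> exists2 c, c \in L' & no_factors L c != 0%N /\
    foldr (fun c g => if no_factors L c is _.+1 then rcons c 1 else g) [::] L' =
    rcons c 1 by exact: key.
elim: L' => //= c L' IH; rewrite inE.
case E : (no_factors L c) => [|k] h0; last first.
  by exists c; [exact: mem_head|rewrite E].
case/predU1P: h0 => [e|{}c0L]; first by move: nf0; rewrite e E.
by have [c' c'L ?] := IH c0L; exists c' => //; rewrite inE c'L orbT.
Qed.

End ListPolynomials.

Lemma enum_listsP (F : fieldType) (elts : seq F) N (L := enum_lists elts N) :
    uniq elts -> (1 < size elts)%N -> (1 < N)%N ->
  exists m, [/\ (0 < m)%N, uniq L, (N <= size L)%N,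
    (forall l, (l \in L) = (size l == m) && all (mem elts) l) &
    (N <= size elts)%N -> m = 1%N].
Proof.
move=> uelts q1 N1; rewrite /L /enum_lists.
(* [m] counts the rounds that extended the lists: either all [k] of them, or fewer because [N] was
   reached. If all [N] rounds extend, [size elts ^ N] exceeds [N], as there are two elements at
   least. *)
have inv k : exists m, let L := iteri k (fun _ L => extend_lists elts N L) [:: [::]] in
    [/\ uniq L, size L = (size elts ^ m)%N,
      (forall l, (l \in L) = (size l == m) && all (mem elts) l),
      m = k \/ (N <= size elts ^ m)%N /\ (m <= k)%N &
      ((0 < k)%N -> (0 < m)%N) /\ ((N <= size elts)%N -> (m <= 1)%N)].
  elim: k => [|k [m [uL szL memL mk [m0 m1]]]].
    exists 0%N; split=> //; last by left.
    by move=> l; rewrite inE; case: l.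
  rewrite /= extend_listsE szL; case: (leqP N (size elts ^ m)) => Nq.
    exists m; split=> //; first by right; split=> //; case: mk => [->|[_ /leqW]].
    by split=> // _; case: (m) Nq => //; rewrite expn0; lia.
  have {}mk : m = k by case: mk => // -[]; lia.
  set L' := iteri k _ _ in uL szL memL *.
  exists m.+1; split.
  - by apply: allpairs_uniq => // -[x1 l1] [x2 l2] _ _ /= [-> ->].
  - by rewrite size_allpairs szL expnS.
  - case=> [|x l]; first by apply/negbTE/allpairsP => -[[? ?] [_ _]].
    rewrite eqSS /= andbCA -memL; apply/allpairsP/andP => [[[y l'] /= [yin l'in [-> ->]]]|[xin lin]] //.
    by exists (x, l).
  - by left; rewrite mk.
  split=> // Nelts; case: (m) Nq => // m'; rewrite expnS => lt.
  have : (0 < size elts ^ m')%N by rewrite expn_gt0; lia.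
  by nia.
have [m [uL szL memL mk [m0 m1]]] := inv N.
exists m; split=> //; first by apply: m0; lia.
- rewrite szL; case: mk => [->|[]//]; exact: ltnW (ltn_expl _ q1).
- by move=> /m1; have := m0 (ltnW N1); lia.
Qed.

(* Its cost does not depend on the length of the list: the input list of field
   elements may be much longer than the running time allowed. *)
Definition take_term G (tN : tm G TNat) (tl : tm G (TList TFld)) :
    tm G (TList TFld) :=
  let state := TProd (TList TFld) (TList TFld) in
  let new_acc := Cons (Var (VZ _ TFld))
    (Snd (Var (VS TFld (VS (TList TFld) (VS TNat (VZ G state)))))) in
  Snd (NatRec tN (Pair tl (Nil _ _))
    (ListCase (Fst (Var (VS TNat (VZ G state)))) (Var (VS TNat (VZ G state)))
      (Pair (Var (VS TFld (VZ _ (TList TFld)))) new_acc))).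

Lemma eval_take_term F G (tN : tm G TNat) tl (e : env F G) :
  eval (take_term tN tl) e = rev (take (eval tN e) (eval tl e : seq F)).
Proof.
rewrite /=; set l := (eval tl e : seq F); set f := (fun _ _ => _).
suff itE j : iteri j f (l, [::]) = (drop j l, rev (take j l)) by rewrite itE.
elim: j => [|j /= ->]; first by rewrite drop0 take0.
have [jl|lj] := ltnP j (size l).
  by rewrite /f /= (drop_nth 0 jl) /= (take_nth 0 jl) rev_rcons.
by rewrite /f /= drop_oversize // drop_oversize ?leqW // !take_oversize ?leqW.
Qed.

Lemma cost_take_term F G (tN : tm G TNat) tl (e : env F G) :
  (cost (take_term tN tl) e <= cost tN e + cost tl e + eval tN e * 9 + 4)%N.
Proof.
rewrite [cost _ _]/=; set S := (\sum_(_ < _) _)%N.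
suff : (S <= eval tN e * 9)%N by move: (cost _ _) (cost _ _) => a b; lia.
rewrite /S -[X in (_ <= X * _)%N]card_ord -sum_nat_const; apply: leq_sum => k _.
by case: (iteri _ _ _).1.
Qed.

(** The input list lies at the bottom of the context. Terms built for a context without it are run
    above it through this renaming, so their time bounds do not involve its length. *)
Fixpoint append_var H G A (v : var G A) : var (G ++ H) A :=
  match v in var G A return var (G ++ H) A with
  | VZ _ _ => VZ _ _
  | VS _ _ _ v => VS _ (append_var H v)
  end.

Fixpoint env_prefix F H G : env F (G ++ H) -> env F G :=
  match G return env F (G ++ H) -> env F G with
  | [::] => fun _ => tt
  | A :: G => fun e => (e.1, env_prefix e.2)
  end.

Lemma renames_append F H G (e : env F (G ++ H)) :
  renames (@append_var H G) e (env_prefix e).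
Proof. by move=> A v; elim: v e => //= *. Qed.

(** * The complete program and its cost *)

Definition curve_degree (r s n : nat) : nat := (r * s ^ 2 * n)%N.

Definition num_points (n r s d delta k : nat) : nat :=
  (d * delta * curve_degree r s n * k.+1)%N.

Definition nat_ctx : seq ty := nseq 7 TNat.

(** [N] is computed from the naturals alone, at most [N] elements of the input list are copied, and
    the rest of the computation sees only this copy. If floor(1/eps) is 0, the output is the
    polynomial X with no points, at constant cost. *)
Lemma hs_program_exists : exists (P : hs_program) (C : nat), (2 <= C)%N /\
  forall (F : fieldType) n r s d delta (elts : seq F),
    (eval P (hs_input n r s d delta 0 elts) = ([:: 0; 1], [::]) /\
     (cost P (hs_input n r s d delta 0 elts) <= C)%N) /\
    forall k, (0 < n)%N -> (0 < r)%N -> (0 < s)%N -> (0 < d)%N -> (0 < delta)%N ->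
      let N := num_points n r s d delta k.+1 in
      eval P (hs_input n r s d delta k.+1 elts) =
        hitting_set n (curve_degree r s n) N (rev (take N elts)) /\
      (cost P (hs_input n r s d delta k.+1 elts) <= C * N.+1 ^ C)%N.
Proof.
have hi G (n r s : forall F, env F G -> den F TNat) :
    polytime n -> polytime r -> polytime s ->
    polytime (A := TNat) (fun F e => curve_degree (r F e) (s F e) (n F e)).
  by move=> hn hr hs; do !apply: polytime_mul.
pose fN F (e : env F nat_ctx) : den F TNat :=
  num_points e.2.1 e.2.2.1 e.2.2.2.1 e.2.2.2.2.1 e.2.2.2.2.2.1 e.1.+1.
have [tN [tNE [c1 tNc] _]] : polytime fN.
  apply: polytime_mul; last by do 2!apply: polytime_succ; ptvar.
  apply: polytime_mul; first by apply: polytime_mul; ptvar.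
  by apply: hi; ptvar.
pose G0 := TList TFld :: TNat :: nat_ctx.
pose fH F (e : env F G0) : den F (TProd (TList TFld) (TList (TList (TList TFld)))) :=
  hitting_set e.2.2.2.1 (curve_degree e.2.2.2.2.1 e.2.2.2.2.2.1 e.2.2.2.1) e.2.1 e.1.
have [tH [tHE [c2 tHc] _]] : polytime fH.
  by apply: polytime_hitting_set; try (by ptvar); apply: hi; ptvar.
pose H := [:: TList TFld].
pose elts_var : tm (TNat :: nat_ctx ++ H) (TList TFld) :=
  Var (VS _ (VS _ (VS _ (VS _ (VS _ (VS _ (VS _ (VS _ (VZ [::] (TList TFld)))))))))).
pose tN' := rename tN (@append_var H nat_ctx).
pose tT := take_term (Var (VZ _ _)) elts_var.
pose tH' := rename tH (@append_var H G0).
pose main : tm (nat_ctx ++ H) (TProd (TList TFld) (TList (TList (TList TFld)))) :=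
  Let tN' (Let tT tH').
pose k_var : tm (behead nat_ctx ++ H) TNat :=
  Var (VS _ (VS _ (VS _ (VS _ (VS _ (VZ H TNat)))))).
pose P : hs_program :=
  NatCase k_var (Pair (Cons (FZero _) (Cons (FOne _) (Nil _ _))) (Nil _ _)) main.
(* Both polynomial-time stages run in environments of size at most 9 N, whence the powers of 9; 60
   covers [take_term] and the fixed overhead; the summands [c1] and [c2] make [C] an upper bound for
   the exponents. *)
pose C := (9 ^ c1 + 9 ^ c2 + 60 + c1 + c2)%N.
exists P, C; split; first by rewrite /C; lia.
move=> F n r s d delta elts; split; first by split=> //; rewrite /= /C; lia.
move=> k n0 r0 s0 d0 delta0 N.
pose e0 : env F nat_ctx := (k, (n, (r, (s, (d, (delta, (k.+1, tt))))))).
pose e1 : env F (nat_ctx ++ H) := (k, hs_input n r s d delta k.+1 elts).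
have e10 : env_prefix e1 = e0 by [].
have evN : eval tN' e1 = N.
  by rewrite (rename_eval tN (renames_append e1)) tNE.
pose l := rev (take N elts).
pose eN : env F (TNat :: nat_ctx ++ H) := (N, e1).
pose e2 : env F (G0 ++ H) := (l, eN).
have evT : eval tT eN = l by exact: eval_take_term.
split.
  change (eval tH' ((eval tT (eval tN' e1, e1), (eval tN' e1, e1)) : env F (G0 ++ H)) =
    hitting_set n (curve_degree r s n) N l).
  by rewrite evN evT (rename_eval tH (renames_append e2)) tHE.
change ((cost tN' e1 + (cost tT (eval tN' e1, e1) +
    cost tH' ((eval tT (eval tN' e1, e1), (eval tN' e1, e1)) : env F (G0 ++ H))).+1)%N.+3
    <= C * N.+1 ^ C)%N.
rewrite evN evT.
have NE : N = (d * delta * (r * s ^ 2 * n) * k.+2)%N by [].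
have N_gt0 : (0 < N)%N by rewrite NE !muln_gt0 d0 delta0 r0 s0 n0.
(* Every input is a positive factor of the product [N], hence at most [N]; so a cost polynomial in
   the inputs is polynomial in the number of points. *)
have dvdN x : (x %| N -> x <= N)%N by apply: dvdn_leq.
have nN : (n <= N)%N by apply: dvdN; rewrite NE dvdn_mulr // dvdn_mull // dvdn_mull.
have rN : (r <= N)%N.
  by apply: dvdN; rewrite NE dvdn_mulr // dvdn_mull // dvdn_mulr // dvdn_mulr.
have sN : (s <= N)%N.
  by apply: dvdN; rewrite NE dvdn_mulr // dvdn_mull // dvdn_mulr // dvdn_mull // dvdn_mulr.
have dN : (d <= N)%N by apply: dvdN; rewrite NE dvdn_mulr // dvdn_mulr // dvdn_mulr.
have deltaN : (delta <= N)%N by apply: dvdN; rewrite NE dvdn_mulr // dvdn_mulr // dvdn_mull.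
have kN : (k.+2 <= N)%N by apply: dvdN; rewrite NE dvdn_mull.
have sz0 : (esize e0 <= 7 * N)%N by rewrite /=; lia.
have szl : (size l <= N)%N by rewrite size_rev size_take_min geq_minl.
have pow c x : (x <= 9 * N)%N -> (x.+2 ^ c <= 9 ^ c * N.+1 ^ c)%N.
  by move=> xN; rewrite -expnMn; case: c => // c; rewrite leq_exp2r //; lia.
have costN : (cost tN' e1 <= 9 ^ c1 * N.+1 ^ c1)%N.
  rewrite (rename_cost tN (renames_append e1)); apply: leq_trans (tNc _ _) _.
  by apply: pow; apply: leq_trans sz0 _; rewrite leq_mul2r orbT.
have costH : (cost tH' e2 <= 9 ^ c2 * N.+1 ^ c2)%N.
  rewrite (rename_cost tH (renames_append e2)); apply: leq_trans (tHc _ _) _.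
  have -> : env_prefix e2 = (l, (N, e0)) by [].
  have -> : esize ((l, (N, e0)) : env F G0) = (tsize (A := TList TFld) l + (N + esize e0))%N by [].
  by apply: pow; rewrite tsize_poly; lia.
have costT : (cost tT eN <= 15 * N)%N.
  apply: leq_trans (cost_take_term _ _ _) _.
  have -> : eval (Var (VZ _ _)) eN = N by [].
  by rewrite [cost _ _]/= [cost _ _]/=; lia.
have powC c : (c <= C)%N -> (N.+1 ^ c <= N.+1 ^ C)%N by move=> cC; rewrite leq_pexp2l.
have p1 := powC c1 ltac:(rewrite /C; lia).
have p2 := powC c2 ltac:(rewrite /C; lia).
have p3 : (N.+1 <= N.+1 ^ C)%N by rewrite -[X in (X <= _)%N]expn1 powC // /C; lia.
have q1 : (9 ^ c1 * N.+1 ^ c1 <= 9 ^ c1 * N.+1 ^ C)%N by rewrite leq_mul2l p1 orbT.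
have q2 : (9 ^ c2 * N.+1 ^ c2 <= 9 ^ c2 * N.+1 ^ C)%N by rewrite leq_mul2l p2 orbT.
have -> : (C * N.+1 ^ C = 9 ^ c1 * N.+1 ^ C + 9 ^ c2 * N.+1 ^ C + (60 + c1 + c2) * N.+1 ^ C)%N.
  by rewrite {1}/C -!addnA !mulnDl !addnA.
have q3 : (60 * N.+1 <= (60 + c1 + c2) * N.+1 ^ C)%N.
  by apply: leq_mul => //; rewrite -addnA leq_addr.
move: costN costH costT q1 q2 q3; rewrite -/eN -/e2.
move: (cost tN' e1) (cost tT eN) (cost tH' e2) (9 ^ c1 * _)%N (9 ^ c2 * _)%N (_ * N.+1 ^ C)%N.
by move=> *; lia.
Qed.

(** * The irreducibility test *)

Section MonicLists.

Variable F : fieldType.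

Lemma size_Poly_rcons1 (c : seq F) : size (Poly (rcons c 1)) = (size c).+1.
Proof. by rewrite (PolyK (c := 0)) ?last_rcons ?oner_eq0 ?size_rcons. Qed.

Lemma Poly_mkseq (p : {poly F}) m :
  (size p <= m)%N -> Poly (mkseq (fun j => p`_j) m) = p.
Proof.
move=> pm; apply/polyP => j; rewrite coef_Poly.
have [jm|mj] := ltnP j m; first by rewrite nth_mkseq.
by rewrite !nth_default ?size_mkseq // (leq_trans pm).
Qed.

Lemma Poly_inj_size (l l' : seq F) : size l = size l' -> Poly l = Poly l' -> l = l'.
Proof.
move=> szl e; apply: (@eq_from_nth _ 0) => // j _.
by have := congr1 (fun p : {poly F} => p`_j) e; rewrite /= !coef_Poly.
Qed.

(** In a proper factorization of a polynomial of degree [m] both factors have size at most [m], so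
    over the full field they occur in [L], padded with zeros. Degree one is irreducible anyway,
    whatever the available elements. *)
Lemma no_factors_irreducible m (elts : seq F) L c :
    (0 < m)%N -> (forall l, (l \in L) = (size l == m) && all (mem elts) l) ->
    m = 1%N \/ (forall x, x \in elts) ->
    c \in L -> no_factors L c != 0%N ->
  irreducible_poly (Poly (rcons c 1)).
Proof.
move=> m0 memL hm cL nf; have /andP[/eqP szc _] : (size c == m) && all (mem elts) c.
  by rewrite -memL.
have szg := size_Poly_rcons1 c; rewrite szc in szg.
set g := Poly _ in szg *.
have g0 : g != 0 by rewrite -size_poly_gt0 szg.
split; first by rewrite szg.
move=> q szq qg; rewrite -dvdp_size_eqp // szg.
have q0 : q != 0 by apply: contraNneq g0 => q0; move: qg; rewrite q0 dvd0p.
have [u gE] := dvdpP _ _ qg.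
have u0 : u != 0 by apply: contraNneq g0 => u0; rewrite gE u0 mul0r.
have qle : (size q <= m.+1)%N by rewrite -szg dvdp_leq.
rewrite eqn_leq qle /=; apply: contraNT nf; rewrite -ltnNge => qlt.
have szuq : (size u + size q = m.+2)%N.
  have := size_mul u0 q0; rewrite -gE szg; move: q0 u0; rewrite -!size_poly_gt0.
  by move: (size u) (size q) => a b; lia.
have q1 : (1 < size q)%N by rewrite ltn_neqAle eq_sym szq size_poly_gt0.
case: hm => [m1|allF]; first by move: qlt q1; rewrite m1; move: (size q); lia.
have inL (p : {poly F}) : mkseq (fun j => p`_j) m \in L.
  rewrite memL size_mkseq eqxx; apply/allP => x _; exact: allF.
apply/no_factorsP; exists (mkseq (fun j => u`_j) m), (mkseq (fun j => q`_j) m).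
split=> //; rewrite !Poly_mkseq //; last by move: szuq q1; move: (size u) (size q) => a b; lia.
Qed.

(** For m = 1 a product of members of [L] is constant, so every candidate passes. Over the full
    field an irreducible monic polynomial of degree [m] passes: in a product equal to it one factor
    would be a unit and the other too large for [L]. *)
Lemma no_factors_exists m (elts : seq F) L :
    (0 < m)%N -> uniq elts -> (0 < size L)%N ->
    (forall l, (l \in L) = (size l == m) && all (mem elts) l) ->
    m = 1%N \/ (forall x, x \in elts) ->
  exists2 c, c \in L & no_factors L c != 0%N.
Proof.
move=> m0 uelts L0 memL hm.
have szL h : h \in L -> (size (Poly h) <= m)%N.
  by rewrite memL => /andP[/eqP <- _]; apply: size_Poly.
case: hm => [m1|allF].
  have [c cL] : exists c, c \in L by case: (L) L0 => // c L' _; exists c; rewrite mem_head.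
  exists c => //; apply/no_factorsP => -[h [h' [hL h'L e]]].
  have szc : size c = 1%N by move: cL; rewrite memL m1 => /andP[/eqP].
  have := size_Poly_rcons1 c; rewrite -e szc.
  have := szL _ hL; have := szL _ h'L; rewrite m1.
  have := size_polyMleq (Poly h) (Poly h').
  by move: (size _) (size _) (size _) => a b d; lia.
have [g gmon [szg girr]] := irreducible_poly_exists_enum uelts allF m0.
exists (mkseq (fun j => g`_j) m).
  by rewrite memL size_mkseq eqxx; apply/allP => x _; apply: allF.
apply/no_factorsP => -[h [h' [hL h'L e]]].
have eg : Poly h * Poly h' = g.
  rewrite e; apply/polyP => j; rewrite coef_Poly nth_rcons size_mkseq.
  case: ltngtP => jm; first by rewrite nth_mkseq.
    by rewrite nth_default // szg.
  by move/monicP: gmon; rewrite lead_coefE szg jm.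
have g0 : g != 0 by rewrite -size_poly_gt0 szg.
have /norP[h0 h'0] : ~~ ((Poly h == 0) || (Poly h' == 0)) by rewrite -mulf_eq0 eg.
have [h1|h1] := eqVneq (size (Poly h)) 1%N.
  have := size_mul h0 h'0; rewrite eg szg h1; have := szL _ h'L.
  by move: (size _) => a; lia.
have : Poly h %| g by rewrite -eg dvdp_mulr.
move/(girr.2 _ h1)/eqp_size; rewrite szg => szh.
by have := szL _ hL; rewrite szh ltnn.
Qed.

End MonicLists.

(** Otherwise [p] would be coprime to [g], also over [E], and they could not share a root. *)
Lemma in_alg_root_eq0 (F : fieldType) (E : fieldExtType F) (g p : {poly F})
    (theta : E) :
    irreducible_poly g -> root (map_poly (in_alg E) g) theta ->
    (size p < size g)%N -> (map_poly (in_alg E) p).[theta] = 0 -> p = 0.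
Proof.
move=> girr groot szp p0; apply/eqP/negPn/negP => pn0.
have : coprimep g p.
  rewrite irreducible_poly_coprime //; apply/negP => /(dvdp_leq pn0).
  by rewrite leqNgt szp.
rewrite -(coprimep_map (in_alg E)) => /coprimep_root /(_ groot).
by rewrite p0 eqxx.
Qed.

(** * Points of the curve over the extension *)

Section CurvePoints.

Variables (F : fieldType) (E : fieldExtType F) (theta : E) (n' i : nat).
Let n := n'.+1.

Definition curve_shift (a : 'I_n) : F := - (nat_of_ord a)%:R.

Definition parameter (z : seq F) : E := (map_poly (in_alg E) (Poly z)).[theta].

Lemma decode_curve_point z (a : 'I_n) :
  decode_point theta n (curve_point n i z) a =
  (map_poly (in_alg E) (curve i curve_shift a)).[parameter z].
Proof.
rewrite ffunE /curve /curve_weight rmorphXn rmorphB /= map_polyX map_polyC /=.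
rewrite !hornerE /curve_shift /= scaleNr opprK.
case: a => -[|a] lt_a; first by rewrite scale0r addr0 expr1.
rewrite /curve_point /= nth_mkseq //.
rewrite Poly_ppow Poly_paddc rmorphXn rmorphD /= map_polyC !hornerE.
by [].
Qed.

Lemma meval_curve_point (f : {mpoly F[n]}) z :
  (map_mpoly (in_alg E) f).@[decode_point theta n (curve_point n i z)] =
  (map_poly (in_alg E) (restrict i curve_shift f)).[parameter z].
Proof.
rewrite mevalE (perm_big _ (msupp_map_mpoly f (fmorph_inj (in_alg E)))) /=.
rewrite /restrict /mmap rmorph_sum horner_sum; apply: eq_bigr => m _.
rewrite mcoeff_map_mpoly rmorphM /= map_polyC hornerM hornerC; congr (_ * _).
rewrite /mmap1 rmorph_prod horner_prod; apply: eq_bigr => a _.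
by rewrite decode_curve_point [in RHS]rmorphXn /= horner_exp.
Qed.

(** The difference of two such lists is a polynomial of degree below that of [g], so it vanishes at
    [theta] only if it is zero; equal lengths then make the lists themselves equal. *)
Lemma parameter_inj (g : {poly F}) m :
    irreducible_poly g -> root (map_poly (in_alg E) g) theta -> size g = m.+1 ->
  {in [pred z | size z == m] &, injective parameter}.
Proof.
move=> girr groot szg z z' /eqP szz /eqP szz' e.
apply: Poly_inj_size; first by rewrite szz szz'.
apply/eqP; rewrite -subr_eq0; apply/eqP.
apply: (in_alg_root_eq0 girr groot); last first.
  by rewrite rmorphB hornerD hornerN -/(parameter z) -/(parameter z') e subrr.
rewrite szg ltnS; apply: leq_trans (size_polyD _ _) _; rewrite size_polyN geq_max.
by rewrite -{1}szz -{1}szz' !size_Poly.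
Qed.

(** The parameters of the points where [f] vanishes are distinct roots in [E] of the restricted
    polynomial. *)
Lemma count_curve_points (f : {mpoly F[n]}) (Z : seq (seq F)) D :
    {in Z &, injective parameter} -> uniq Z ->
    restrict i curve_shift f != 0 ->
    (size (restrict i curve_shift f) <= D.+1)%N ->
  (size Z <= nonzero_count f
    [seq decode_point theta n (curve_point n i z) | z <- Z] + D)%N.
Proof.
move=> pinj uZ rf0 rfD; rewrite /nonzero_count count_map.
rewrite -(count_predC (fun z => parameter z \in root (map_poly (in_alg E) (restrict i curve_shift f)))) .
rewrite addnC; apply: leq_add.
  apply: sub_count => z; rewrite /= meval_curve_point; exact: id.
rewrite -size_filter; set Z0 := [seq z <- Z | _].
rewrite -(size_map parameter) -ltnS; apply: leq_trans rfD.
rewrite -(size_map_poly (in_alg E)); apply: max_poly_roots.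
- by rewrite map_poly_eq0.
- by apply/allP => _ /mapP[z + ->]; rewrite mem_filter => /andP[].
- rewrite map_inj_in_uniq ?filter_uniq // => z z'; rewrite !mem_filter.
  by move=> /andP[_ ?] /andP[_ ?]; apply: pinj.
Qed.

End CurvePoints.

(** * Constants and the final theorem *)

Lemma characteristic_small_nat (F : fieldType) p T :
  has_characteristic F p -> p = 0%N \/ (T < p)%N -> small_nat_neq0 F T.
Proof.
move=> hF hp m /andP[m0 mT]; apply/negP => m0F.
have [q qF] := natf0_pchar m0 m0F.
case: hF => [[_ char0]|pF]; first by have := char0 q; rewrite qF.
case: hp => [p0|Tp]; first by move: pF; rewrite p0 inE.
have : (p %| m)%N by rewrite (dvdn_pcharf pF).
by move/(dvdn_leq m0); lia.
Qed.

Lemma root_presentsE (F : fieldType) (g : {poly F}) : irreducible_poly g ->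
  exists (E : fieldExtType F) (theta : E), root_presents g theta /\
    (size g = 2 -> {:E}%VS = 1%VS).
Proof.
move=> girr; have [E dimE [theta groot gen]] := irredp_FAdjoin girr.
exists E, theta; split=> // szg; apply/eqP; rewrite eq_sym eqEdim sub1v.
by rewrite dimE szg dimv1.
Qed.

(** Links the assumed bound on the characteristic with the degree of a restricted circuit;
    positivity of [delta] makes the inequality strict. *)
Lemma restricted_degree_lt n r s d delta :
    (0 < r)%N -> (0 < d)%N -> (0 < delta)%N ->
  (d * delta * curve_degree r s n < r * d * delta * (s ^ 2 * n + delta))%N.
Proof.
move=> r0 d0 delta0; rewrite /curve_degree mulnDr -[(r * _ * n)%N]mulnA.
have -> : (d * delta * (r * (s ^ 2 * n)) = r * d * delta * (s ^ 2 * n))%N.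
  by move: (s ^ 2 * n)%N => X; lia.
by rewrite -{1}[(_ * _)%N]addn0 ltn_add2l !muln_gt0 r0 d0 delta0.
Qed.

Lemma leq_restricted_degree n r s d delta :
    (0 < r)%N -> (0 < s)%N -> (0 < d)%N -> (0 < delta)%N ->
  (n <= d * delta * curve_degree r s n)%N.
Proof.
by move=> r0 s0 d0 delta0; rewrite /curve_degree mulnA leq_pmull // !muln_gt0 d0 delta0 r0 s0.
Qed.

(** The factor 2 stems from k + 2 <= 2 (k + 1), where k + 1 stands for floor(1/eps). *)
Lemma num_points_le n r s d delta k :
    (0 < n)%N -> (0 < r)%N -> (0 < s)%N -> (0 < delta)%N ->
  (num_points n r s d delta k.+1 <=
   2 * (r ^ 4 * s ^ 4 * n ^ 2 * d * delta ^ 3) * k.+1)%N.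
Proof.
move=> n0 r0 s0 delta0.
have -> : (2 * (r ^ 4 * s ^ 4 * n ^ 2 * d * delta ^ 3) * k.+1 =
    (d * delta * curve_degree r s n) * (r ^ 3 * s ^ 2 * n * delta ^ 2 * (2 * k.+1)))%N.
  by rewrite /curve_degree; lia.
rewrite leq_mul2l; apply/orP; right.
have : (0 < r ^ 3 * s ^ 2 * n * delta ^ 2)%N by rewrite !muln_gt0 r0 s0 delta0 n0.
by move: (_ * delta ^ 2)%N => X; nia.
Qed.

Theorem theorem3p2 :
  exists (P : hs_program) (C : nat),
  forall (n r s d delta : nat),
    (0 < n)%N -> (0 < r)%N -> (0 < s)%N -> (0 < d)%N -> (0 < delta)%N ->
    ((r - 1) ^ 2 <= d + 1)%N ->
  forall (F : fieldType) (p : nat),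
    has_characteristic F p ->
    p = 0%N \/ (r * d * delta * (s ^ 2 * n + delta) <= p)%N ->
  forall (R : archiRealFieldType) (eps : R), 0 < eps ->
  let bound : R :=
    C%:R * (r ^ 4 * s ^ 4 * n ^ 2 * d * delta ^ 3)%:R / eps in
  forall elts : seq F, uniq elts ->
    bound <= (size elts)%:R \/ (forall x : F, x \in elts) ->
  let input := hs_input n r s d delta (Num.truncn eps^-1) elts in
  let g : seq F := (eval P input).1 in
  let pts : seq (seq (seq F)) := (eval P input).2 in
  exists (E : fieldExtType F) (theta : E),
    let H : seq {ffun 'I_n -> E} := map (decode_point theta n) pts in
    root_presents (Poly g) theta /\
    (bound <= (size elts)%:R -> {:E}%VS = 1%VS) /\
    all (fun pt => size pt == n) pts /\
    uniq H /\
    (eps <= 1 -> (0 < size H)%N) /\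
    (size H)%:R <= bound /\
    (cost P input <= C * (size H).+1 ^ C)%N /\
    forall f : {mpoly F[n]},
      f != 0 -> sum_pow_sparse r d s delta f ->
      (1 - eps) * (size H)%:R <= (nonzero_count f H)%:R.
Proof.
have [P [C [C2 hP]]] := hs_program_exists; exists P, C.
move=> [//|n'] r s d delta n0 r0 s0 d0 delta0 rd F p hchar hp R eps eps0 bound.
move=> elts uelts helts.
have [[ev0 cost0] hk] := hP F n'.+1 r s d delta elts.
have bound0 : 0 <= bound by rewrite !mulr_ge0 ?invr_ge0 ?ler0n // ltW.
have eps_ge0 : 0 <= eps^-1 by rewrite invr_ge0 ltW.
cbv zeta; case Ek: (Num.truncn eps^-1) => [|k].
  (* Here eps > 1: the set is empty and [F] is presented over itself by the polynomial X. *)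
  rewrite ev0 /=.
  have -> : cons_poly 0 (cons_poly 1 0) = 'X - 0%:P :> {poly F}.
    by rewrite !cons_poly_def mul0r add0r mul1r polyC0 addr0 subr0.
  have [E [theta [pres dimE]]] := root_presentsE (irredp_XsubC (0 : F)).
  exists E, theta; split=> //; split; first by rewrite size_XsubC in dimE => _; apply: dimE.
  do 2!split=> //; split.
    move=> eps1; have /truncn0Pn/negP[] := Ek.
    by rewrite invf_ge1.
  split=> //; split; first by rewrite exp1n muln1.
  by move=> f _ _; rewrite mulr0.
have {hk} [ev costk] := hk k n0 r0 s0 d0 delta0.
set i := curve_degree r s n'.+1 in ev; set N := num_points n'.+1 r s d delta k.+1 in ev costk.
have NE : N = (d * delta * i * k.+2)%N by [].
have iE : i = (r * s ^ 2 * n'.+1)%N by [].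
have i_gt0 : (0 < i)%N by rewrite iE !muln_gt0 r0 s0.
have N2 : (1 < N)%N.
  have : (0 < d * delta * i)%N by rewrite 2!muln_gt0 d0 delta0.
  by rewrite NE; move: (d * delta * i)%N => D; nia.
have /andP[k_le k_gt] : k.+1%:R <= eps^-1 < k.+2%:R by rewrite -Ek truncn_itv.
have N_le : N%:R <= bound.
  apply: (@le_trans _ _ ((2 * (r ^ 4 * s ^ 4 * n'.+1 ^ 2 * d * delta ^ 3)) * k.+1)%:R).
    by rewrite ler_nat num_points_le.
  by rewrite natrM /bound ler_pM ?ler0n // natrM ler_wpM2r ?ler0n // ler_nat.
pose l := rev (take N elts); rewrite -/l in ev.
have ul : uniq l by rewrite rev_uniq take_uniq.
have szl : size l = minn N (size elts) by rewrite size_rev size_take_min.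
(* Either there are enough elements for tuples of length 1, or the shortened list is the whole
   field, over which the irreducibility test is complete. *)
have small : (N <= size elts)%N \/ (forall x, x \in l).
  have [|lt] := leqP N (size elts); [by left|right=> x].
  rewrite mem_rev take_oversize; last exact: ltnW.
  case: helts => // /(le_trans N_le); by rewrite ler_nat leqNgt lt.
have l2 : (1 < size l)%N.
  case: small => [le|allF]; first by rewrite szl (minn_idPl le).
  have : {subset [:: 0; 1 : F] <= l} by move=> x _; apply: allF.
  by move/(uniq_leq_size _); apply; rewrite /= inE eq_sym oner_eq0.
have [m [m0 uL NL memL m1]] := enum_listsP ul l2 N2.
set L := enum_lists l N in uL NL memL.
have mN : m = 1%N \/ (forall x, x \in l).
  by case: small => [le|]; [left; apply: m1; rewrite szl (minn_idPl le)|right].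
have [c0 c0L nf0] := no_factors_exists m0 ul (leq_trans (ltnW N2) NL) memL mN.
have [c cL [nf gE]] := find_irreducibleP c0L nf0.
have girr := no_factors_irreducible m0 memL mN cL nf.
have szg : size (Poly (rcons c 1)) = m.+1.
  by rewrite size_Poly_rcons1; move: cL; rewrite memL => /andP[/eqP->].
have [E [theta [pres dimE]]] := root_presentsE girr.
have ptsE : (eval P (hs_input n'.+1 r s d delta k.+1 elts)).2 =
    [seq curve_point n'.+1 i z | z <- take N L].
  rewrite ev /hitting_set /= -/L -(mkseq_nth [::] (take N L)) size_takel //.
  rewrite /mkseq -map_comp; apply/eq_in_map => j.
  by rewrite mem_iota add0n => /andP[_ jN] /=; rewrite nth_take.
exists E, theta; rewrite ptsE ev /= -/L gE.
have sizeZ z : z \in take N L -> size z == m by move/mem_take; rewrite memL => /andP[].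
have pinj : {in take N L &, injective (parameter theta)}.
  have [_ groot _] := pres.
  move=> z z' /sizeZ zm /sizeZ zm'; exact: (parameter_inj girr groot szg).
have szZ : size (take N L) = N by rewrite size_takel.
split=> //; split.
  move=> /(le_trans N_le); rewrite ler_nat => le; apply: dimE.
  by rewrite szg m1 // szl (minn_idPl le).
split; first by apply/allP => _ /mapP[z _ ->]; rewrite /= size_mkseq.
rewrite -map_comp size_map szZ; split.
  (* Coordinate 0 of a point is its parameter, so distinct parameters give distinct points. *)
  rewrite map_inj_in_uniq ?take_uniq // => z z' zin z'in.
  move=> /(congr1 (fun v : {ffun 'I_n'.+1 -> E} => v ord0)); rewrite /= !ffunE /=.
  exact: pinj.
split; first by rewrite ltnW.
do 2!split=> //.
move=> f f0 fsum.
have FT : small_nat_neq0 F (d * delta * i).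
  apply: (characteristic_small_nat hchar); case: hp => [->|hp]; [by left|right].
  by apply: leq_trans hp; apply: restricted_degree_lt.
(* The shifts are the integers below n, and n does not exceed the degree bound, so they remain
   distinct in [F]. *)
have binj : injective (@curve_shift F n').
  move=> a a' /oppr_inj eaa'; apply: val_inj => /=.
  have ni : (n'.+1 <= d * delta * i)%N by apply: leq_restricted_degree.
  have la := ltn_ord a; have la' := ltn_ord a'.
  clear -FT ni la la' eaa'; case: (ltngtP a a') => // lt.
    have /negP[] := FT (a' - a)%N ltac:(lia).
    by rewrite natrB ?eaa' ?subrr // ltnW.
  have /negP[] := FT (a - a')%N ltac:(lia).
  by rewrite natrB ?eaa' ?subrr // ltnW.
have [rf0 rfsz] := sum_pow_sparse_restrict binj r0 s0 d0 delta0 rd FT f0 fsum.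
have := count_curve_points pinj (take_uniq N uL) rf0 rfsz; rewrite szZ.
set cnt := nonzero_count _ _ => cnt_le.
have : N%:R <= cnt%:R + (d * delta * i)%:R :> R by rewrite -natrD ler_nat.
rewrite mulrBl mul1r lerBlDr => /le_trans; apply; rewrite lerD2l.
(* What remains is D <= eps N for the degree bound D; it holds because N = D (k + 2) and 1/eps < k +
   2. *)
rewrite NE [(_ * k.+2)%:R]natrM mulrCA ler_peMr ?ler0n //.
by rewrite -ler_pdivrMl // mulr1 ltW.
Qed.
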